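(* Given a tensor bundle $\mathcal V$ (over $n$-dimensional manifolds) and two positive integers $k,d$, there exist finitely many indecomposable tensor bundles $\mathcal W_i$ and algebraic natural differential operations $D_i$ of order $\le k$ from $\mathcal V$ to $\mathcal W_i$, of degree $\le d$ in partial derivatives, such that, for every tensor bundle $\mathcal W$, every algebraic natural differential operation $D$ of order $\le k$ from $\mathcal V$ to $\mathcal W$ of degree $\le d$ in partial derivatives is represented as a finite sum $$D v=\sum_{i,p}\Phi_{ip}\bigl(D_i v\otimes v^{\otimes p}\bigr),\qquad\forall v\in\Gamma(\mathcal V),$$ where $\Phi_{ip}:\mathcal W_i\otimes\mathrm S^p\mathcal V\to\mathcal W$ are natural linear maps, i.e. maps of tensor bundles given on fibres by $\mathrm{GL}_n$-equivariant linear maps (compositions of contractions, permutations of indices, tensor products with the identity operator, and linear combinations).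
   Context: $\mathbb K=\mathbb R$ or $\mathbb C$; manifolds are smooth $\mathbb K$-manifolds (real smooth, resp. complex analytic) of dimension $n$. $\Gamma(\mathcal V)$ denotes sections of $\mathcal V$. A tensor bundle $\mathcal V$ with typical fibre $V$ is the vector bundle associated with the (co)frame bundle by a finite-dimensional rational representation $V$ of $\mathrm{GL}_n=\mathrm{GL}_n(\mathbb K)$; it is thus naturally defined on every $n$-manifold. It is indecomposable if $V$ is an irreducible $\mathrm{GL}_n$-module. $\mathrm{GL}_n^{(k)}$ denotes the group of $k$-jets at $0$ of local diffeomorphisms of $\mathbb K^n$ fixing $0$. $V^{(k)}=\bigoplus_{l=0}^{k}\mathrm S^l(\mathbb K^{n})^*\otimes V$ is the space of $k$-jets at $0$ of $V$-valued functions on $\mathbb K^n$ (local sections of $\mathcal V$), with the $\mathrm{GL}_n^{(k+1)}$-action induced by the transformation of tensor fields under local diffeomorphisms fixing $0$; it is not the tensor product action. $\mathrm{GL}_n^{(k+1)}$ acts on the typical fibre $W$ of $\mathcal W$ through $\mathrm{GL}_n$. A differential operation $D$ of order $\le k$ from $\mathcal V$ to $\mathcal W$ is a map on sections induced by a morphism of bundles from the $k$-jet bundle of $\mathcal V$ to $\mathcal W$ ($Dv(z)$ depends only on the $k$-jet of $v$ at $z$). It is natural if its fibre map $\delta:V^{(k)}\to W$, in local coordinates, does not depend on the point and is $\mathrm{GL}_n^{(k+1)}$-equivariant. It is algebraic if $\delta$ is a polynomial map. It has degree $\le d$ in partial derivatives if $\delta$ has degree $\le d$ in the coordinates of $V^{(k)}_+=\bigoplus_{l=1}^{k}\mathrm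 S^l(\mathbb K^{n})^*\otimes V$ (with no restriction on the degree in the coordinates of the summand $V$, $l=0$). *)

(* Defs.v *)
From HB Require Import structures.
From mathcomp Require Import all_boot all_order all_fingroup all_algebra.
From mathcomp Require Import complex.
From mathcomp Require Import all_classical all_reals all_analysis.
From mathcomp Require mpoly.
(* The notations of [mpoly] clash with those of the analysis library. *)
Import -(notations) mpoly.

Set Implicit Arguments.
Unset Strict Implicit.
Unset Printing Implicit Defensive.

Import Order.TTheory GRing.Theory Num.Theory.
Import numFieldNormedType.Exports.

Local Open Scope classical_set_scope.
Local Open Scope ring_scope.

Local Notation "{ 'mpoly' R [ N ] }" := (mpoly N R)
  (at level 0, R, N at level 2, format "{ 'mpoly'  R [ N ] }") : type_scope.

Section Differentiability.
Variables (K : numFieldType) (V W : normedModType K).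

Lemma differentiableI (f : V -> W) (df : {linear V -> W}) x :
  continuous df -> f \o shift x = cst (f x) + df +o_ 0 id ->
  differentiable f x.
Proof.
move=> dfc dxf.
have hdf h : (f \o shift x = cst (f x) + h +o_ 0 id) ->
    h = f \o shift x - cst (f x) +o_ 0 id.
  move=> hdf; apply: eqaddoE.
  rewrite hdf addrAC -!addrA addrC !addrA subrK.
  rewrite -[LHS]addr0 -addrA; congr (_ + _).
  by apply/eqP; rewrite eq_sym addrC addr_eq0 oppo.
apply/diffP => /=.
apply: (@getPex _ (fun (df : {linear V -> W}) => continuous df /\
  forall y, f y = f (lim (nbhs x)) + df (y - lim (nbhs x))
                  +o_(y \near x) (y - lim (nbhs x)))).
exists df; split=> //; apply: eqaddoEx => z.
rewrite (hdf _ dxf) !addrA lim_id // /(_ \o _) /= subrK [f _ + _]addrC addrK.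
rewrite -addrA -[LHS]addr0; congr (_ + _).
apply/eqP; rewrite eq_sym addrC addr_eq0 oppox; apply/eqP.
rewrite [in LHS]littleo_center0 (comp_centerK x id).
by rewrite -[- _ in RHS](comp_centerK x).
Qed.

Lemma near_eq_differentiable (f g : V -> W) x :
  (\forall z \near x, f z = g z) -> differentiable f x -> differentiable g x.
Proof.
move=> fg df; apply: (@differentiableI _ ('d f x)).
  exact: diff_continuous.
have /eqaddoP h := diff_locally df.
apply/eqaddoP => e e0; have := h e e0.
have fg0 : \forall z \near (0 : V), f (z + x) = g (z + x).
  by move: fg; rewrite (near_shift 0) subr0.
apply: filterS2 fg0 => z fgz.
rewrite /= [(_ - _ : _ -> _) _]/(_ - _) [X in _ -> `|X| <= _]/(_ - _) /=.
by rewrite -fgz -(nbhs_singleton fg).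
Qed.

Lemma differentiable_shift (f : V -> W) a x :
  differentiable f (x + a) -> differentiable (f \o shift a) x.
Proof.
move=> df; apply: (@differentiableI _ ('d f (x + a))).
  exact: diff_continuous.
have -> : (f \o shift a) \o shift x = f \o shift (x + a).
  by apply/funext => z /=; rewrite addrA.
exact: (diff_locally df).
Qed.

End Differentiability.

Section Calculus.
Variables (K : numFieldType) (n : nat).
Implicit Types (x y a : 'cV[K]_n) (f g : 'cV[K]_n -> K^o).
Implicit Types (s : seq 'I_n) (U : set 'cV[K]_n).

Definition partial (i : 'I_n) f : 'cV[K]_n -> K^o :=
  fun x => 'D_(delta_mx i 0) f x.

Definition partials s f : 'cV[K]_n -> K^o := foldr partial f s.

Definition mpartial (al : multinom n) f : 'cV[K]_n -> K^o :=
  partials (flatten [seq nseq (al i) i | i <- enum 'I_n]) f.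

Definition smooth_at m (F : 'cV[K]_n -> 'cV[K]_m) x :=
  forall s (i : 'I_m), differentiable (partials s (fun z => F z i 0)) x.

(* Only meaningful for [U] open; for K = C, smoothness is holomorphy. *)
Definition smooth_on m U (F : 'cV[K]_n -> 'cV[K]_m) :=
  forall x, U x -> smooth_at F x.

Definition jacmx m (F : 'cV[K]_n -> 'cV[K]_m) x : 'M[K]_(m, n) :=
  \matrix_(i, j) partial j (fun z => F z i 0) x.

(* [F] represents the germ at 0 of a local diffeomorphism fixing 0, and [G]
   the germ of its inverse. *)
Record local_diffeo (F G : 'cV[K]_n -> 'cV[K]_n) : Prop := LocalDiffeo {
  ld_fix : F 0 = 0;
  ld_fixV : G 0 = 0;
  ld_smooth : \forall x \near (0 : 'cV[K]_n), smooth_at F x;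
  ld_smoothV : \forall x \near (0 : 'cV[K]_n), smooth_at G x;
  ld_K : \forall x \near (0 : 'cV[K]_n), G (F x) = x;
  ld_KV : \forall x \near (0 : 'cV[K]_n), F (G x) = x }.

(* Coordinates on V^(k) for V = K^m: pairs of a multi-index of degree at most k
   and a component.  A jet is given by its partial derivatives. *)
Definition jet_coord (k m : nat) : finType := (bmultinom n k.+1 * 'I_m)%type.

Definition jet_order k m (t : jet_coord k m) : nat := mdeg t.1.

Definition jet_space (k m : nat) := {ffun jet_coord k m -> K}.

Definition jet k m (v : 'cV[K]_n -> 'cV[K]_m) x : jet_space k m :=
  [ffun t : jet_coord k m => mpartial t.1 (fun z => v z t.2 0) x].

Lemma near_eq_partials f g s x : (\forall z \near x, f z = g z) ->
  \forall z \near x, partials s f z = partials s g z.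
Proof.
elim: s x => //= i s IH x fg.
apply: filterS (near_join fg) => z fgz.
by apply: near_eq_derive; apply: IH.
Qed.

Lemma partials_shift f s a : partials s (f \o shift a) = partials s f \o shift a.
Proof.
elim: s => //= i s ->; apply/funext => x.
apply: (congr1 (fun u : K -> K^o => lim (u @ 0^'))).
by apply/funext => h /=; rewrite addrA.
Qed.

Definition dsmooth (r : nat) U f := forall s, (size s <= r)%N ->
  forall x, U x -> differentiable (partials s f) x.

Lemma dsmoothS r U f :
  (forall x, U x -> differentiable f x) -> (forall i, dsmooth r U (partial i f)) ->
  dsmooth r.+1 U f.
Proof.
move=> f0 fS; elim/last_ind => [_|s i _]; first exact: f0.
rewrite size_rcons ltnS => sr x Ux; rewrite /partials foldr_rcons.
exact: fS.
Qed.

Lemma dsmooth_partial r U f i : dsmooth r.+1 U f -> dsmooth r U (partial i f).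
Proof.
move=> fS s sr x Ux; have := fS (rcons s i); rewrite /partials foldr_rcons.
by apply=> //; rewrite size_rcons.
Qed.

Lemma dsmooth_le q r U f : (q <= r)%N -> dsmooth r U f -> dsmooth q U f.
Proof. by move=> qr fS s sq; apply: fS; apply: leq_trans qr. Qed.

Lemma dsmooth_eq r U f g : open U -> (forall x, U x -> f x = g x) ->
  dsmooth r U f -> dsmooth r U g.
Proof.
move=> oU fg fS s sr x Ux; apply: near_eq_differentiable (fS s sr x Ux).
by apply: near_eq_partials; apply: filterS (open_nbhs_nbhs (conj oU Ux)).
Qed.

Lemma dsmooth_cst r U (c : K) : dsmooth r U (fun=> c).
Proof.
elim: r c => [|r IH] c; first by case=> // _ x _; apply: differentiable_cst.
apply: dsmoothS => [x _|i]; first exact: differentiable_cst.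
suff -> : partial i (fun=> c) = fun=> 0 by exact: IH.
by apply/funext => x; rewrite /partial derive_cst.
Qed.

Lemma dsmoothD r U f g : open U -> dsmooth r U f -> dsmooth r U g ->
  dsmooth r U (fun x => f x + g x).
Proof.
move=> oU; elim: r f g => [|r IH] f g fS gS.
  case=> // _ x Ux; apply: (differentiableD (fS [::] isT _ Ux) (gS [::] isT _ Ux)).
have f1 x : U x -> differentiable f x by exact: (fS [::]).
have g1 x : U x -> differentiable g x by exact: (gS [::]).
apply: dsmoothS => [x Ux|i]; first exact: differentiableD (f1 _ Ux) (g1 _ Ux).
apply: dsmooth_eq (IH _ _ (dsmooth_partial i fS) (dsmooth_partial i gS)) => //.
move=> x Ux; rewrite /partial -[RHS]/('D_(delta_mx i 0) (f + g) x) deriveD //;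
  by apply: diff_derivable; first [exact: f1|exact: g1].
Qed.

Lemma dsmoothM r U f g : open U -> dsmooth r U f -> dsmooth r U g ->
  dsmooth r U (fun x => f x * g x).
Proof.
move=> oU; elim: r f g => [|r IH] f g fS gS.
  case=> // _ x Ux; apply: (differentiableM (fS [::] isT _ Ux) (gS [::] isT _ Ux)).
have f1 x : U x -> differentiable f x by exact: (fS [::]).
have g1 x : U x -> differentiable g x by exact: (gS [::]).
apply: dsmoothS => [x Ux|i]; first exact: differentiableM (f1 _ Ux) (g1 _ Ux).
have A := IH _ _ (dsmooth_le (leqnSn r) fS) (dsmooth_partial i gS).
have B := IH _ _ (dsmooth_le (leqnSn r) gS) (dsmooth_partial i fS).
apply: dsmooth_eq (dsmoothD oU A B) => //.
move=> x Ux; rewrite /partial -[RHS]/('D_(delta_mx i 0) (f * g) x) deriveM //;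
  by apply: diff_derivable; first [exact: f1|exact: g1].
Qed.

Lemma dsmooth_sum r U (I : Type) (t : seq I) (F : I -> 'cV[K]_n -> K^o) :
  open U -> (forall i, dsmooth r U (F i)) ->
  dsmooth r U (fun x => \sum_(i <- t) F i x).
Proof.
move=> oU FS; elim: t => [|i t IH].
  by under eq_fun do rewrite big_nil; exact: dsmooth_cst.
by under eq_fun do rewrite big_cons; exact: dsmoothD.
Qed.

Lemma dsmooth_prod r U (I : Type) (t : seq I) (F : I -> 'cV[K]_n -> K^o) :
  open U -> (forall i, dsmooth r U (F i)) ->
  dsmooth r U (fun x => \prod_(i <- t) F i x).
Proof.
move=> oU FS; elim: t => [|i t IH].
  by under eq_fun do rewrite big_nil; exact: dsmooth_cst.
by under eq_fun do rewrite big_cons; exact: dsmoothM.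
Qed.

Lemma dsmoothX r U f e : open U -> dsmooth r U f ->
  dsmooth r U (fun x => f x ^+ e).
Proof.
move=> oU fS; elim: e => [|e IH].
  by under eq_fun do rewrite expr0; exact: dsmooth_cst.
by under eq_fun do rewrite exprS; exact: dsmoothM.
Qed.

Lemma dsmooth_meval r U N (p : {mpoly K[N]}) (F : 'I_N -> 'cV[K]_n -> K^o) :
  open U -> (forall i, dsmooth r U (F i)) ->
  dsmooth r U (fun x => meval (F^~ x) p).
Proof.
move=> oU FS; under eq_fun do rewrite mevalE.
apply: dsmooth_sum => // al; apply: dsmoothM => //; first exact: dsmooth_cst.
by apply: dsmooth_prod => // i; exact: dsmoothX.
Qed.

Lemma smooth_onP m U (F : 'cV[K]_n -> 'cV[K]_m) :
  smooth_on U F <-> forall r i, dsmooth r U (fun z => F z i 0).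
Proof.
split=> [FS r i s _ x Ux|FS x Ux s i]; first exact: FS.
exact: (FS (size s) i).
Qed.

Lemma dsmooth_partials r U s f :
  (forall q, dsmooth q U f) -> dsmooth r U (partials s f).
Proof.
move=> fS t tr x Ux; rewrite /partials -foldr_cat.
exact: (fS (size (t ++ s))).
Qed.

Lemma near_eq_jet k m (v w : 'cV[K]_n -> 'cV[K]_m) x :
  (\forall z \near x, v z = w z) -> jet k v x = jet k w x.
Proof.
move=> vw; apply/ffunP => t; rewrite !ffunE.
apply: (nbhs_singleton (near_eq_partials _ _)).
by apply: filterS vw => z ->.
Qed.

Lemma jet_shift k m (v : 'cV[K]_n -> 'cV[K]_m) a x :
  jet k (v \o shift a) x = jet k v (x + a).
Proof.
apply/ffunP => t; rewrite !ffunE /mpartial.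
by rewrite (partials_shift (fun z => v z t.2 0)).
Qed.

Lemma smooth_at_shift m (F : 'cV[K]_n -> 'cV[K]_m) a x :
  smooth_at F (x + a) -> smooth_at (F \o shift a) x.
Proof.
move=> FS s i; rewrite (partials_shift (fun z => F z i 0)).
exact: differentiable_shift.
Qed.

Lemma partial_subc i f (c : K) : partial i (fun z => f z - c) = partial i f.
Proof.
apply/funext => x; apply: (congr1 (fun u : K -> K^o => lim (u @ 0^'))).
by apply/funext => h /=; rewrite opprB addrA subrK.
Qed.

Lemma smooth_at_subc m (F : 'cV[K]_n -> 'cV[K]_m) b x :
  smooth_at F x -> smooth_at (fun z => F z - b) x.
Proof.
move=> FS s i.
have -> : (fun z => (F z - b) i 0) = (fun z => F z i 0 - b i 0).
  by apply/funext => z; rewrite !mxE.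
case/lastP: s => [|s j].
  by apply: differentiableB (differentiable_cst _ _); exact: (FS [::]).
by have := FS (rcons s j) i; rewrite /partials !foldr_rcons partial_subc.
Qed.

End Calculus.

Section TensorBundles.
Variables (K : numFieldType) (n : nat).

(* A rational representation of GL_n(K) on K^m, i.e. the typical fibre of a
   tensor bundle; only the values at invertible matrices matter. *)
Record tensor_bundle := TensorBundle {
  fdim : nat;
  fibre_act :> 'M[K]_n -> 'M[K]_fdim;
  fibre_act1 : fibre_act 1%:M = 1%:M;
  fibre_actM : {in unitmx &, forall g h, fibre_act (g *m h) = fibre_act g *m fibre_act h};
  fibre_act_rational : exists (e : nat) (P : 'M[{mpoly K[n * n]}]_fdim),
    forall g, g \in unitmx ->
      fibre_act g = (\det g) ^- e *: map_mx (meval (mxvec g 0)) P }.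

Definition indecomposable (V : tensor_bundle) :=
  (0 < fdim V)%N /\
  forall U : {vspace 'cV[K]_(fdim V)},
    (forall g u, g \in unitmx -> u \in U -> V g *m u \in U) ->
    U = 0%VS \/ U = fullv.

(* Transform of the local tensor field [v] by the local diffeomorphism [F] with
   inverse [G]. *)
Definition pushforward (V : tensor_bundle) (F G : 'cV[K]_n -> 'cV[K]_n)
    (v : 'cV[K]_n -> 'cV[K]_(fdim V)) : 'cV[K]_n -> 'cV[K]_(fdim V) :=
  fun y => V (jacmx F (G y)) *m v (G y).

(* Equivariance under the group of (k+1)-jets at 0 of local diffeomorphisms,
   which acts on k-jets by transforming representatives. *)
Definition jet_equivariant k (V W : tensor_bundle)
    (delta : jet_space K n k (fdim V) -> 'cV[K]_(fdim W)) :=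
  forall F G, local_diffeo F G ->
  forall v, (\forall x \near (0 : 'cV[K]_n), smooth_at v x) ->
    delta (jet k (@pushforward V F G v) 0) = W (jacmx F 0) *m delta (jet k v 0).

(* [delta] is a polynomial map, of degree at most [d] in the coordinates of
   positive order. *)
Definition algebraic_deg_le k d m m'
    (delta : jet_space K n k m -> 'cV[K]_m') :=
  exists P : 'I_m' -> {mpoly K[#|jet_coord n k m|]},
    (forall J a, delta J a 0 = meval (fun i => J (enum_val i)) (P a)) /\
    forall a (mu : multinom _), mu \in msupp (P a) ->
      (\sum_(i | 0 < jet_order (enum_val i)) mu i <= d)%N.

(* Algebraic natural differential operations of order <= k and of degree <= d
   in partial derivatives, given by their fibre maps. *)
Record natop k d (V W : tensor_bundle) := NatOp {
  fibre_map : jet_space K n k (fdim V) -> 'cV[K]_(fdim W);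
  natop_algebraic : algebraic_deg_le d fibre_map;
  natop_natural : jet_equivariant fibre_map }.

(* The fibre of W (x) V^(x)p, in coordinates. *)
Definition tens_index (W V : tensor_bundle) (p : nat) : finType :=
  ('I_(fdim W) * {ffun 'I_p -> 'I_(fdim V)})%type.

Definition tens W V p := {ffun tens_index W V p -> K^o}.

Definition tens_act (W V : tensor_bundle) p (g : 'M[K]_n) (t : tens W V p) :
    tens W V p :=
  [ffun ab : tens_index W V p => \sum_(cd : tens_index W V p)
     W g ab.1 cd.1 * (\prod_q V g (ab.2 q) (cd.2 q)) * t cd].

Definition tens_perm (W V : tensor_bundle) p (s : 'S_p) (t : tens W V p) :
    tens W V p :=
  [ffun ab : tens_index W V p => t (ab.1, [ffun q => ab.2 (s q)])].

(* w (x) v^(x)p *)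
Definition tens_pow (W V : tensor_bundle) p
    (w : 'cV[K]_(fdim W)) (v : 'cV[K]_(fdim V)) : tens W V p :=
  [ffun ab : tens_index W V p => w ab.1 0 * \prod_q v (ab.2 q) 0].

(* Natural linear maps W1 (x) S^p V -> W2.  As S^p V is the quotient of V^(x)p
   by the permutations of the factors, these are the equivariant linear maps on
   W1 (x) V^(x)p that are invariant under these permutations. *)
Record natlin (W1 V : tensor_bundle) p (W2 : tensor_bundle) := NatLin {
  natlin_map :> {linear {ffun tens_index W1 V p -> K^o} -> 'cV[K]_(fdim W2)};
  natlin_sym : forall s t, natlin_map (tens_perm s t) = natlin_map t;
  natlin_equiv : forall g t, g \in unitmx ->
    natlin_map (tens_act g t) = W2 g *m natlin_map t }.

(* A smooth n-manifold over K, given by an atlas: [coord c] maps [chart_dom c]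
   homeomorphically onto [chart_cod c], with inverse [param c]; the values of these
   functions elsewhere are irrelevant. *)
Record manifold := Manifold {
  carrier :> topologicalType;
  carrier_hausdorff : hausdorff_space carrier;
  carrier_countable : @second_countable carrier;
  chart : Type;
  chart_dom : chart -> set carrier;
  chart_cod : chart -> set 'cV[K]_n;
  coord : chart -> carrier -> 'cV[K]_n;
  param : chart -> 'cV[K]_n -> carrier;
  chart_dom_open : forall c, open (chart_dom c);
  chart_cod_open : forall c, open (chart_cod c);
  coordP : forall c x, chart_dom c x -> chart_cod c (coord c x);
  paramP : forall c y, chart_cod c y -> chart_dom c (param c y);
  coordK : forall c x, chart_dom c x -> param c (coord c x) = x;
  paramK : forall c y, chart_cod c y -> coord c (param c y) = y;
  coord_continuous : forall c x, chart_dom c x -> {for x, continuous (coord c)};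
  param_continuous : forall c y, chart_cod c y -> {for y, continuous (param c)};
  chart_cover : forall x, exists c, chart_dom c x;
  transition_smooth : forall c c',
    smooth_on (chart_cod c `&` (param c @^-1` chart_dom c')) (coord c' \o param c) }.

Definition transition (M : manifold) (c c' : chart M) : 'cV[K]_n -> 'cV[K]_n :=
  coord c' \o param c.

(* Sections over M of the tensor bundle V, given by their expressions in the
   charts, which transform by [V]. *)
Record tsection (V : tensor_bundle) (M : manifold) := TSection {
  local_expr :> forall c : chart M, 'cV[K]_n -> 'cV[K]_(fdim V);
  local_smooth : forall c, smooth_on (chart_cod c) (local_expr c);
  local_compat : forall (c c' : chart M) y, chart_cod c y -> chart_dom c' (param c y) ->
    local_expr c' (transition c c' y) =
      V (jacmx (transition c c') y) *m local_expr c y }.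

Definition natop_expr k d (V W : tensor_bundle) (D : natop k d V W)
    (M : manifold) (v : tsection V M) (c : chart M) (y : 'cV[K]_n) :=
  fibre_map D (jet k (v c) y).

Lemma natop_smooth k d V W (D : natop k d V W) M (v : tsection V M) c :
  smooth_on (chart_cod c) (natop_expr D v c).
Proof.
apply/smooth_onP => r a; have [P [PE _]] := natop_algebraic D.
have -> : (fun z => natop_expr D v c z a 0) =
    (fun z => meval (fun i => jet k (v c) z (enum_val i)) (P a)).
  by apply/funext => z; rewrite /natop_expr PE.
apply: (@dsmooth_meval _ _ r (chart_cod c) _ (P a)
  (fun i z => jet k (v c) z (enum_val i))); first exact: chart_cod_open.
move=> i; rewrite (_ : (fun z => _) = mpartial (enum_val i).1
    (fun z => v c z (enum_val i).2 0)); last by apply/funext => z; rewrite ffunE.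
apply: dsmooth_partials => q.
exact: ((smooth_onP _ _).1 (@local_smooth _ _ v c)).
Qed.

Lemma overlap_open (M : manifold) (c c' : chart M) :
  open (chart_cod c `&` (param c @^-1` chart_dom c')).
Proof.
rewrite openE => y [cy dy]; apply: filterI.
  exact: open_nbhs_nbhs (conj (@chart_cod_open M c) cy).
apply: (param_continuous cy).
exact: open_nbhs_nbhs (conj (@chart_dom_open M c') dy).
Qed.

Lemma natop_compat k d V W (D : natop k d V W) M (v : tsection V M)
    (c c' : chart M) y : chart_cod c y -> chart_dom c' (param c y) ->
  natop_expr D v c' (transition c c' y) =
    W (jacmx (transition c c') y) *m natop_expr D v c y.
Proof.
move=> cy dy.
pose tau := transition c c'; pose sig := transition c' c; pose z := tau y.
have cz : chart_cod c' z by apply: coordP.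
have sz : sig z = y by rewrite /sig /z /tau /transition /= coordK // paramK.
have dz : chart_dom c (param c' z).
  by rewrite /z /tau /transition /= coordK //; apply: paramP.
pose F x := tau (x + y) - z; pose G x := sig (x + z) - y.
have nshift (P : set 'cV[K]_n) (a : 'cV[K]_n) :
    nbhs a P -> \forall x \near (0 : 'cV[K]_n), P ((x : 'cV[K]_n) + a).
  by move/(nbhs0P P a); apply: filterS => x; rewrite addrC.
have nO : \forall x \near (0 : 'cV[K]_n),
    chart_cod c (x + y) /\ chart_dom c' (param c (x + y)).
  have := open_nbhs_nbhs (conj (@overlap_open M c c') (conj cy dy)).
  by move/nshift.
have nO' : \forall x \near (0 : 'cV[K]_n),
    chart_cod c' (x + z) /\ chart_dom c (param c' (x + z)).
  have := open_nbhs_nbhs (conj (@overlap_open M c' c) (conj cz dz)).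
  by move/nshift.
have jacF x : jacmx F x = jacmx tau (x + y).
  apply/matrixP => i j; rewrite !mxE.
  have -> : (fun w => F w i 0) = (fun w => tau (w + y) i 0 - z i 0).
    by apply/funext => w; rewrite !mxE.
  rewrite partial_subc.
  exact: (congr1 (@^~ x) (partials_shift (fun w => tau w i 0) [:: j] y)).
have FG : local_diffeo F G.
  split.
  - by rewrite /F add0r subrr.
  - by rewrite /G add0r sz subrr.
  - apply: filterS nO => x nx; apply: smooth_at_subc.
    by apply: smooth_at_shift; apply: transition_smooth.
  - apply: filterS nO' => x nx; apply: smooth_at_subc.
    by apply: smooth_at_shift; apply: transition_smooth.
  - apply: filterS nO => x [cx dx].
    by rewrite /F /G subrK /sig /tau /transition /= coordK // paramK // addrK.
  - apply: filterS nO' => x [cx dx].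
    by rewrite /F /G subrK /sig /tau /transition /= coordK // paramK // addrK.
have vS : \forall x \near (0 : 'cV[K]_n), smooth_at (v c \o shift y) x.
  apply: filterS nO => x [cx _]; apply: smooth_at_shift.
  exact: local_smooth.
have := natop_natural D FG vS.
rewrite jacF add0r jet_shift add0r => <-.
rewrite /natop_expr; congr (fibre_map D _).
rewrite -[transition c c' y]add0r -jet_shift; apply: near_eq_jet.
apply: filterS nO' => x [cx dx] /=.
rewrite /pushforward jacF /G /= subrK.
have dc : chart_dom c' (param c (sig (x + z))).
  by rewrite /sig /transition /= coordK //; exact: paramP.
rewrite -(local_compat v (coordP dx) dc).
by rewrite /sig /transition /= coordK // paramK.
Qed.

(* The operation [D] on sections over M. *)
Definition natop_apply k d (V W : tensor_bundle) (D : natop k d V W)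
    (M : manifold) (v : tsection V M) : tsection W M :=
  TSection (natop_smooth D v) (natop_compat D v).

End TensorBundles.

(* Main.v *)
(* Call a function on jets "of order 0" if it is a polynomial in the components of
   the 0-jet v(0).  The components of all natural operations of degree <= d in the
   positive-order coordinates lie in a finitely generated module over the Noetherian
   ring of order-0 polynomials, so finitely many of them, components of D_1, ..., D_r,
   generate the submodule which they span.  Splitting the targets of D_1, ..., D_r
   into irreducible bundles gives the W_i and D_i, and every D is of the form
   D v = sum_(i,p) Phi0_ip (D_i v (x) v^p) for linear maps Phi0_ip that need not be
   equivariant.  Since D and the D_i are natural under linear changes of coordinates,
   the identity is preserved when Phi0_ip is replaced by W(g) Phi0_ip g^-1, hence also
   when it is averaged over g in GL_n; the averages are natural.

   Averages over GL_n (K) exist over any subfield K of C, by Cayley's argument: on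
   functions det(g)^-e q(g) with q a polynomial, take the pairing of q with det^e for
   the form <p, q> = (p(d/dx) q)(0).  Linear substitutions are adjoint to their
   transposes for this form, so the pairing is translation invariant, and it does not
   vanish on det^e because the form is positive on real polynomials.  The same
   averages give complete reducibility. *)
Require Import Defs.
From HB Require Import structures.
From mathcomp Require Import all_boot all_order all_fingroup all_algebra.
From mathcomp Require Import complex.
From mathcomp Require Import all_classical all_reals all_analysis.
From mathcomp Require mpoly.
Import -(notations) mpoly.

Set Implicit Arguments.
Unset Strict Implicit.
Unset Printing Implicit Defensive.

Import Order.TTheory GRing.Theory Num.Theory.
Import numFieldNormedType.Exports.

Local Open Scope ring_scope.
Local Open Scope complex_scope.

Local Notation "{ 'mpoly' R [ N ] }" := (mpoly N R)
  (at level 0, R, N at level 2, format "{ 'mpoly'  R [ N ] }") : type_scope.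
Local Notation mX m := (mpolyX _ m).
Local Notation mXU i := (mpolyX _ (mnm1 i)).

(** * Induction on polynomials *)

Section PolynomialFunctions.
Variable N : nat.

(** Each monomial is peeled off one variable at a time, by induction on its degree. Identities on
    evaluation, derivation and substitution then reduce to constants, sums and multiplication by a
    variable. *)
Lemma mpoly_ring_ind (R : comNzRingType) (P : {mpoly R[N]} -> Prop) :
  (forall c, P (mpolyC N c)) -> (forall p q, P p -> P q -> P (p + q)) ->
  (forall i p, P p -> P (mXU i * p)) -> forall p, P p.
Proof.
move=> PC PD PX; elim/mpolyind => [|c m p _ _ Pp]; first by rewrite -mpolyC0.
apply: PD => //; rewrite -mul_mpolyC.
elim: {m}(mdeg m) {-2}m (erefl (mdeg m)) => [|e IH] m dm.
  by move/eqP: dm; rewrite mdeg_eq0 => /eqP ->; rewrite mpolyX0 mulr1.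
have /existsP [i mi] : [exists i, m i != 0%N].
  apply/existsPn => m0; suff m00 : m = @mnm0 N by rewrite m00 mdeg0 in dm.
  by apply/mnmP => i; rewrite mnm0E; apply/eqP; have := m0 i; rewrite negbK.
have mE : m = mnm_add (mnm1 i) (mnm_sub m (mnm1 i)).
  by rewrite addmC submK // lep1mP.
rewrite mE mpolyXD mulrCA; apply: PX; apply: IH.
by apply/eqP; rewrite -(eqn_add2l 1) -{1}(mdeg1 i) -mdegD -mE dm.
Qed.

End PolynomialFunctions.

(** * A polynomial that vanishes everywhere is zero *)

Section Density.
Variables (K : numFieldType) (N : nat).

Lemma poly_eq0_everywhere (p : {poly K}) : (forall t, p.[t] = 0) -> p = 0.
Proof.
move=> p0; apply/eqP; apply: contraT => pN0.
have := max_poly_roots pN0 (rs := [seq i%:R | i <- iota 0 (size p)]).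
rewrite size_map size_iota ltnn => -> //.
  by apply/allP => t _; rewrite /root p0.
by rewrite map_inj_uniq ?iota_uniq // => i j /eqP; rewrite eqr_nat => /eqP.
Qed.

(** The restriction of [p] to the line through [x] in direction [i] is a univariate polynomial
    [mmap polyC h p] with infinitely many roots. It is therefore zero, and so is its derivative at
    0, which is the partial derivative at [x]. *)
Lemma mderiv_eq0_everywhere i (p : {mpoly K[N]}) :
  (forall x, meval x p = 0) -> forall x, meval x (mderiv i p) = 0.
Proof.
move=> p0 x; pose h j : {poly K} := (x j)%:P + (j == i)%:R *: 'X.
have hval q t : (mmap polyC h q).[t] = meval (fun j => x j + (j == i)%:R * t) q.
  elim/mpoly_ring_ind: q => [c|q r IHq IHr|j q IH].
  - by rewrite mmapC hornerC mevalC.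
  - by rewrite mmapD mevalD hornerD IHq IHr.
  - by rewrite !rmorphM /= mmapX mmap1U hornerM IH mevalXU /h !hornerE.
have hder q : mmap polyC h (mderiv i q) = (mmap polyC h q)^`().
  elim/mpoly_ring_ind: q => [c|q r IHq IHr|j q IH].
  - by rewrite mderivC mmap0 mmapC derivC.
  - by rewrite mderivD !mmapD derivD IHq IHr.
  - rewrite mderivM mmapD !rmorphM /= !mmapX !mmap1U derivM IH; congr (_ * _ + _).
    rewrite mderivX mnm1E mmapZ mmapX /h derivD derivC derivZ derivX add0r.
    case: eqVneq => [->|_] /=; last by rewrite !mulr0n polyC0 mul0r scale0r.
    suff -> : mnm_sub (mnm1 i) (mnm1 i) = @mnm0 N by rewrite mmap11 alg_polyC mulr1.
    by apply/mnmP => l; rewrite mnmBE subnn mnm0E.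
have u0 : mmap polyC h p = 0 by apply: poly_eq0_everywhere => t; rewrite hval.
have := hval (mderiv i p) 0; rewrite hder u0 derivC horner0 => /esym.
by rewrite (@meval_eq _ _ _ x) // => j; rewrite mulr0 addr0.
Qed.

Lemma meval0_mcoeff (q : {mpoly K[N]}) : meval (fun=> 0) q = mcoeff (@mnm0 N) q.
Proof.
elim/mpoly_ring_ind: q => [c|q r IHq IHr|j q IH].
- by rewrite mevalC mcoeffC eqxx mulr1.
- by rewrite mevalD mcoeffD IHq IHr.
- by rewrite mevalM mevalXU mul0r rmorphM /= mcoeffX mnm1_eq0 mul0r.
Qed.

(** All iterated derivatives of [p] vanish as functions. At the origin they give the coefficients of
    [p] up to products of factorials, which are nonzero in characteristic 0. *)
Lemma mpoly_eq0_everywhere (p : {mpoly K[N]}) :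
  (forall x, meval x p = 0) -> p = 0.
Proof.
move=> p0; apply/mpolyP => m; rewrite mcoeff0.
have: forall x, meval x (mderivm m p) = 0.
  rewrite mderivm_foldr; elim: (enum _) => //= i s IH x.
  by elim: (m i) x => [|e IHe] //=; apply: mderiv_eq0_everywhere.
move=> /(_ (fun=> 0)).
by rewrite meval0_mcoeff mcoeff_mderivm addm0 => /eqP; rewrite mulrn_eq0 -[_ == 0%N]negbK
  -lt0n prodn_gt0 /= => [/eqP //|i]; rewrite ffact_gt0.
Qed.
End Density.

(** * The Fischer pairing and linear substitutions *)

Section Fischer.
Variables (K : numFieldType) (N : nat).
Implicit Types (p q r : {mpoly K[N]}) (A : 'M[K]_N).

(** The apolar pairing (q(d/dx) p)(0), bilinear and without complex conjugation; the first argument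
    is the differential operator. *)
Definition fischer q p : K :=
  \sum_(m <- msupp q) mcoeff m q * mcoeff (@mnm0 N) (mderivm m p).

Lemma fischer_seqE (s : seq (multinom N)) q p : uniq s -> {subset msupp q <= s} ->
  fischer q p = \sum_(m <- s) mcoeff m q * mcoeff (@mnm0 N) (mderivm m p).
Proof.
move=> us qs; rewrite /fischer [RHS](bigID (mem (msupp q))) /=.
rewrite [X in _ = _ + X]big1 ?addr0.
  rewrite -[RHS]big_filter; apply: perm_big; apply: uniq_perm => //.
    exact: filter_uniq.
  by move=> m; rewrite mem_filter andb_idr // => /qs.
by move=> m /memN_msupp_eq0 ->; rewrite mul0r.
Qed.

Lemma fischerDl p q r : fischer (p + q) r = fischer p r + fischer q r.
Proof.
have us := undup_uniq (msupp p ++ msupp q).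
rewrite !(fischer_seqE _ us) => [|m mq|m mp|m /msuppD_le mpq];
  rewrite ?mem_undup ?mem_cat ?mq ?mp ?orbT // -?mem_cat //.
by rewrite -big_split; apply: eq_bigr => m _; rewrite mcoeffD mulrDl.
Qed.

Lemma fischerZl c q p : fischer (c *: q) p = c * fischer q p.
Proof.
rewrite (fischer_seqE _ (msupp_uniq q)) => [|m /msuppZ_le //].
by rewrite mulr_sumr; apply: eq_bigr => m _; rewrite mcoeffZ mulrA.
Qed.

Lemma fischerCl c p : fischer (mpolyC N c) p = c * mcoeff (@mnm0 N) p.
Proof.
rewrite (@fischer_seqE [:: @mnm0 N]) => [||m] //.
  by rewrite big_seq1 mcoeffC eqxx mulr1 mderivm0m.
by rewrite msuppC; case: ifP.
Qed.

Lemma fischerXl i q p : fischer (mXU i * q) p = fischer q (mderiv i p).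
Proof.
rewrite (@fischer_seqE [seq mnm_add (mnm1 i) m | m <- msupp q]).
- rewrite big_map; apply: eq_bigr => m _.
  by rewrite [mXU i * q]mulrC mcoeffMX mderivmDm mderivmU1m.
- by rewrite map_inj_uniq ?msupp_uniq //; apply: addmI.
- by move=> m; rewrite mulrC (perm_mem (msuppMX _ _)).
Qed.

Lemma fischer_suml (I : Type) (s : seq I) (F : I -> {mpoly K[N]}) p :
  fischer (\sum_(i <- s) F i) p = \sum_(i <- s) fischer (F i) p.
Proof.
elim: s => [|i s IH]; last by rewrite !big_cons fischerDl IH.
by rewrite !big_nil -mpolyC0 fischerCl mul0r.
Qed.

Lemma fischerDr p q r : fischer p (q + r) = fischer p q + fischer p r.
Proof.
by rewrite -big_split; apply: eq_bigr => m _; rewrite mderivmD mcoeffD mulrDr.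
Qed.

Lemma fischerZr c q p : fischer q (c *: p) = c * fischer q p.
Proof.
rewrite mulr_sumr; apply: eq_bigr => m _.
by rewrite mderivmZ mcoeffZ mulrCA.
Qed.

Lemma fischer_sumr (I : Type) (s : seq I) (F : I -> {mpoly K[N]}) p :
  fischer p (\sum_(i <- s) F i) = \sum_(i <- s) fischer p (F i).
Proof.
elim: s => [|i s IH]; last by rewrite !big_cons fischerDr IH.
by rewrite !big_nil -(scale0r 0) fischerZr mul0r.
Qed.

(** Distinct monomials are orthogonal, so the pairing of [q] with itself is a sum of squares of
    coefficients weighted by factorials. Realness makes these squares nonnegative: over the complex
    numbers x + iy pairs to 0 with itself. *)
Lemma fischer_neq0 q : (forall m, mcoeff m q \is Num.real) -> q != 0 ->
  fischer q q != 0.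
Proof.
move=> qR q0.
have term_ge0 m : 0 <= mcoeff m q * mcoeff (@mnm0 N) (mderivm m q).
  rewrite mcoeff_mderivm addm0 mulrnAr mulrn_wge0 //.
  by rewrite -expr2 real_exprn_even_ge0.
rewrite /fischer psumr_eq0 //; apply/allPn.
exists (mlead q); first exact: mlead_supp.
rewrite /= mcoeff_mderivm addm0 mulrnAr mulrn_eq0 negb_or -lt0n mulf_eq0.
by rewrite mleadc_eq0 orbb q0 andbT prodn_gt0 // => i; rewrite ffact_gt0.
Qed.

Definition linear_subst A p : {mpoly K[N]} :=
  comp_mpoly [tuple \sum_k A i k *: mXU k | i < N] p.

Lemma linear_substM A p q :
  linear_subst A (p * q) = linear_subst A p * linear_subst A q.
Proof. exact: rmorphM. Qed.

Lemma linear_substXU A i : linear_subst A (mXU i) = \sum_k A i k *: mXU k.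
Proof. by rewrite /linear_subst comp_mpolyXU -tnth_nth tnth_mktuple. Qed.

Lemma meval_linear_subst A p x :
  meval x (linear_subst A p) = meval (fun i => \sum_k A i k * x k) p.
Proof.
rewrite comp_mpoly_meval; apply: meval_eq => i; rewrite tnth_mktuple raddf_sum /=.
by apply: eq_bigr => k _; rewrite mevalZ mevalXU.
Qed.

Lemma mderiv_linear_subst i A p :
  mderiv i (linear_subst A p) = \sum_j A j i *: linear_subst A (mderiv j p).
Proof.
elim/mpoly_ring_ind: p => [c|p q IHp IHq|l q IH].
- rewrite /linear_subst comp_mpolyC mderivC big1 // => j _.
  by rewrite mderivC comp_mpoly0 scaler0.
- rewrite /linear_subst comp_mpolyD mderivD IHp IHq -big_split.
  by apply: eq_bigr => j _; rewrite mderivD comp_mpolyD scalerDr.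
rewrite linear_substM mderivM IH.
have -> : mderiv i (linear_subst A (mXU l)) = mpolyC N (A l i).
  rewrite linear_substXU raddf_sum (bigD1 i) //= big1 ?addr0 => [|k ki].
    rewrite mderivZ mderivX mnm1E eqxx scale1r.
    have -> : mnm_sub (mnm1 i) (mnm1 i) = @mnm0 N.
      by apply/mnmP => j; rewrite mnmBE subnn mnm0E.
    by rewrite mpolyX0 alg_mpolyC.
  by rewrite mderivZ mderivX mnm1E (negPf ki) mulr0n scale0r scaler0.
(* Leibniz rule inside the sum: the derivative of the variable [l] survives only for [j = l]. *)
have -> : \sum_j A j i *: linear_subst A (mderiv j (mXU l * q)) =
   \sum_j (A j i *: linear_subst A ((l == j)%:R *: q) +
     linear_subst A (mXU l) * (A j i *: linear_subst A (mderiv j q))).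
  apply: eq_bigr => j _; rewrite -scalerAr -linear_substM -scalerDr.
  rewrite /linear_subst -comp_mpolyD mderivM; congr (_ *: comp_mpoly _ (_ + _)).
  rewrite mderivX mnm1E; case: eqVneq => [->|_]; last by rewrite !scale0r mul0r.
  have -> : mnm_sub (mnm1 j) (mnm1 j) = @mnm0 N.
    by apply/mnmP => k; rewrite mnmBE subnn mnm0E.
  by rewrite mpolyX0 !scale1r mul1r.
rewrite big_split -mulr_sumr mul_mpolyC; congr (_ + _).
rewrite (bigD1 l) //= big1 ?addr0 => [|j jl]; first by rewrite eqxx scale1r.
by rewrite eq_sym (negPf jl) scale0r /linear_subst comp_mpoly0 scaler0.
Qed.

(* By induction on [q], as multiplication by a variable is adjoint to the
   corresponding derivative. *)
Lemma fischer_linear_subst A q p :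
  fischer q (linear_subst A p) = fischer (linear_subst A^T q) p.
Proof.
elim/mpoly_ring_ind: q p => [c|q r IHq IHr|i q IH] p.
- rewrite {2}/linear_subst comp_mpolyC !fischerCl.
  have mev0 r : mcoeff (@mnm0 N) r = meval (fun=> 0) r.
    by rewrite meval0_mcoeff.
  by rewrite !mev0 meval_linear_subst; congr (_ * _); apply: meval_eq => i;
    rewrite big1 // => k _; rewrite mulr0.
- by rewrite /linear_subst comp_mpolyD !fischerDl IHq IHr.
rewrite fischerXl mderiv_linear_subst fischer_sumr linear_substM linear_substXU.
rewrite mulr_suml fischer_suml; apply: eq_bigr => j _.
by rewrite fischerZr -scalerAl fischerZl fischerXl IH mxE.
Qed.
End Fischer.

(** * Cayley's averaging of rational functions on the general linear group *)

Section Averaging.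
Variables (K : numFieldType) (n : nat).
Implicit Types (p q : {mpoly K[n * n]}) (g h : 'M[K]_n) (f : 'M[K]_n -> K).

Definition mx_eval g p : K := meval (mxvec g 0) p.

Definition generic_mx : 'M[{mpoly K[n * n]}]_n :=
  \matrix_(i, j) mXU (mxvec_index i j).

Definition det_poly : {mpoly K[n * n]} := \det generic_mx.

Lemma mx_eval_generic g : map_mx (mx_eval g) generic_mx = g.
Proof. by apply/matrixP => i j; rewrite !mxE /mx_eval mevalXU mxvecE. Qed.

Lemma mx_eval_det g : mx_eval g det_poly = \det g.
Proof. by rewrite -{2}(mx_eval_generic g) det_map_mx. Qed.

Lemma mx_eval_inj p q : (forall g, mx_eval g p = mx_eval g q) -> p = q.
Proof.
move=> pq; apply/eqP; rewrite -subr_eq0; apply/eqP; apply: mpoly_eq0_everywhere => x.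
have := pq (vec_mx (\row_i x i)); rewrite /mx_eval vec_mxK => pqx.
by rewrite mevalB -(@meval_eq _ _ ((\row_i x i) 0) x) -?(@meval_eq _ _ ((\row_i x i) 0) x)
  ?pqx ?subrr // => i; rewrite mxE.
Qed.

Lemma det_poly_neq0 : det_poly != 0.
Proof.
apply/negP => /eqP d0; have := mx_eval_det 1%:M.
by rewrite d0 /mx_eval meval0 det1 => /esym/eqP; rewrite oner_eq0.
Qed.

(** Multiplying both sides by the determinant makes them agree at singular matrices too; the
    determinant can then be cancelled in the polynomial ring. *)
Lemma unit_mx_eval_inj p q :
  (forall g, g \in unitmx -> mx_eval g p = mx_eval g q) -> p = q.
Proof.
move=> pq; apply: (mulfI det_poly_neq0); apply: mx_eval_inj => g.
rewrite /mx_eval !mevalM -!/(mx_eval _ _) mx_eval_det.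
have [gU|] := boolP (g \in unitmx); first by rewrite pq.
by rewrite unitmxE unitfE negbK => /eqP ->; rewrite !mul0r.
Qed.

(** The polynomial of the translated function g -> p(h g). The matrix [lin_mulmx h] acts on row
    vectors from the right, whence the transpose. *)
Definition lmul_poly h p := linear_subst (lin_mulmx h)^T p.

Lemma mx_eval_lmul h g p : mx_eval g (lmul_poly h p) = mx_eval (h *m g) p.
Proof.
rewrite /mx_eval meval_linear_subst; apply: meval_eq => i.
have -> : mxvec (h *m g) = mxvec g *m lin_mulmx h by rewrite mul_vec_lin.
by rewrite mxE; apply: eq_bigr => k _; rewrite mxE mulrC.
Qed.

Lemma lin_mulmx_indexE h i j k l :
  (lin_mulmx h : 'M[K]_(n * n)) (mxvec_index i j) (mxvec_index k l) = h k i * (j == l)%:R.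
Proof.
have -> : (lin_mulmx h : 'M[K]_(n * n)) (mxvec_index i j) (mxvec_index k l) =
    row (mxvec_index i j) (lin_mulmx h) 0 (mxvec_index k l).
  by rewrite [RHS]mxE.
rewrite rowE -mxvec_delta mul_vec_lin mxvecE mxE (bigD1 i) //= big1 ?addr0.
  by rewrite mxE eqxx eq_sym.
by move=> t ti; rewrite mxE (negPf ti) mulr0.
Qed.

(* Up to a constant this is Cayley's operator [det (d/dg) ^ e]. *)
Definition cayley e p :=
  fischer (det_poly ^+ e) p / fischer (det_poly ^+ e) (det_poly ^+ e).

(** The substitution is moved to the other side of the pairing, where it is left multiplication by
    the transpose of [h]; this multiplies the e-th power of the determinant by the scalar
    det(h)^e. *)
Lemma cayley_lmul e h p : cayley e (lmul_poly h p) = \det h ^+ e * cayley e p.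
Proof.
rewrite /cayley /lmul_poly fischer_linear_subst trmxK mulrA; congr (_ * _).
rewrite -fischerZl; congr (fischer _ _).
have -> : lin_mulmx h = (lin_mulmx h^T)^T :> 'M[K]_(n * n).
  apply/matrixP => s t; rewrite [RHS]mxE.
  case/mxvec_indexP: s => i j; case/mxvec_indexP: t => k l.
  by rewrite !lin_mulmx_indexE mxE eq_sym.
apply: mx_eval_inj => g; rewrite -/(lmul_poly _ _) mx_eval_lmul.
rewrite /mx_eval mevalZ !rmorphXn /= -!/(mx_eval _ _) !mx_eval_det.
by rewrite det_mulmx det_tr exprMn.
Qed.

(** The determinant polynomial has coefficients built from signs, hence real, so the normalizing
    denominator in [cayley] is nonzero. *)
Lemma cayley_det e : cayley e (det_poly ^+ e) = 1.
Proof.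
rewrite /cayley divff // fischer_neq0 ?expf_neq0 ?det_poly_neq0 // => m.
apply/mpolyOverP; apply: rpredX; apply: rpred_sum => s _.
apply: rpredM; first by rewrite rpredX // rpredN rpred1.
by apply: rpred_prod => i _; rewrite mxE mpolyOverX.
Qed.

Lemma cayleyD e p q : cayley e (p + q) = cayley e p + cayley e q.
Proof. by rewrite /cayley fischerDr mulrDl. Qed.

Lemma cayleyZ e c p : cayley e (c *: p) = c * cayley e p.
Proof. by rewrite /cayley fischerZr mulrA. Qed.

Definition rational_with e f :=
  exists q, forall g, g \in unitmx -> f g = \det g ^- e * mx_eval g q.

(* Only meaningful if [f] is rational with denominator [det ^ e]. *)
Definition gl_avg e f : K :=
  if pselect (rational_with e f) is left fR then cayley e (projT1 (cid fR)) else 0.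

(** The numerator of [f] over det^e is unique by [unit_mx_eval_inj], so the one chosen in [gl_avg]
    is [q]. *)
Lemma gl_avgE e f q : (forall g, g \in unitmx -> f g = \det g ^- e * mx_eval g q) ->
  gl_avg e f = cayley e q.
Proof.
move=> fq; rewrite /gl_avg; case: pselect => [fR|[]]; last by exists q.
case: cid => r /= fr; congr cayley; apply: unit_mx_eval_inj => g gU.
apply: (@mulfI _ (\det g ^- e)); last by rewrite -fr // -fq.
by rewrite invr_eq0 expf_neq0 // -unitfE -unitmxE.
Qed.

Lemma rational_with_eq e f1 f2 : (forall g, g \in unitmx -> f1 g = f2 g) ->
  rational_with e f1 -> rational_with e f2.
Proof. by move=> f12 [q fq]; exists q => g gU; rewrite -f12 ?fq. Qed.

Lemma eq_gl_avg e f1 f2 : (forall g, g \in unitmx -> f1 g = f2 g) ->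
  gl_avg e f1 = gl_avg e f2.
Proof.
move=> f12; have [[q fq]|nR] := pselect (rational_with e f1).
  by rewrite (gl_avgE fq); apply/esym/gl_avgE => g gU; rewrite -f12 ?fq.
rewrite /gl_avg; case: pselect => // _; case: pselect => // R2; case: nR.
by apply: rational_with_eq R2 => g gU; rewrite f12.
Qed.

Lemma rational_with_cst e c : rational_with e (fun=> c).
Proof.
exists (c *: det_poly ^+ e) => g gU; rewrite /mx_eval mevalZ rmorphXn /=.
rewrite -/(mx_eval _ _) mx_eval_det mulrCA mulVf ?mulr1 //.
by rewrite expf_neq0 // -unitfE -unitmxE.
Qed.

Lemma gl_avg_cst e c : gl_avg e (fun=> c) = c.
Proof.
rewrite (@gl_avgE _ _ (c *: det_poly ^+ e)) ?cayleyZ ?cayley_det ?mulr1 // => g gU.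
rewrite /mx_eval mevalZ rmorphXn /=.
rewrite -/(mx_eval _ _) mx_eval_det mulrCA mulVf ?mulr1 //.
by rewrite expf_neq0 // -unitfE -unitmxE.
Qed.

Lemma rational_withD e f1 f2 : rational_with e f1 -> rational_with e f2 ->
  rational_with e (fun g => f1 g + f2 g).
Proof.
move=> [q1 fq1] [q2 fq2]; exists (q1 + q2) => g gU.
by rewrite /mx_eval mevalD mulrDr fq1 ?fq2.
Qed.

Lemma gl_avgD e f1 f2 : rational_with e f1 -> rational_with e f2 ->
  gl_avg e (fun g => f1 g + f2 g) = gl_avg e f1 + gl_avg e f2.
Proof.
move=> [q1 fq1] [q2 fq2]; rewrite (gl_avgE fq1) (gl_avgE fq2) -cayleyD.
by apply: gl_avgE => g gU; rewrite /mx_eval mevalD mulrDr fq1 ?fq2.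
Qed.

Lemma rational_withZ e c f : rational_with e f -> rational_with e (fun g => c * f g).
Proof.
move=> [q fq]; exists (c *: q) => g gU.
by rewrite /mx_eval mevalZ mulrCA fq.
Qed.

Lemma gl_avgZ e c f : rational_with e f -> gl_avg e (fun g => c * f g) = c * gl_avg e f.
Proof.
move=> [q fq]; rewrite (gl_avgE fq) -cayleyZ.
by apply: gl_avgE => g gU; rewrite /mx_eval mevalZ mulrCA fq.
Qed.

Lemma rational_with_sum e (I : Type) (s : seq I) (F : I -> 'M[K]_n -> K) :
  (forall i, rational_with e (F i)) -> rational_with e (fun g => \sum_(i <- s) F i g).
Proof.
move=> FR; elim: s => [|i s IH].
  by under eq_fun do rewrite big_nil; exact: rational_with_cst.
by under eq_fun do rewrite big_cons; exact: rational_withD.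
Qed.

Lemma gl_avg_sum e (I : Type) (s : seq I) (F : I -> 'M[K]_n -> K) :
  (forall i, rational_with e (F i)) ->
  gl_avg e (fun g => \sum_(i <- s) F i g) = \sum_(i <- s) gl_avg e (F i).
Proof.
move=> FR; elim: s => [|i s IH].
  by under eq_fun do rewrite big_nil; rewrite big_nil gl_avg_cst.
under eq_fun do rewrite big_cons.
by rewrite big_cons gl_avgD ?IH //; exact: rational_with_sum.
Qed.

(** Translation multiplies the denominator by det(h)^e, which cancels the factor produced by
    [cayley_lmul]. *)
Lemma gl_avg_lmul e f h : h \in unitmx -> rational_with e f ->
  gl_avg e (fun g => f (h *m g)) = gl_avg e f.
Proof.
move=> hU [q fq]; rewrite (gl_avgE fq).
have dh : \det h ^+ e != 0 by rewrite expf_neq0 // -unitfE -unitmxE.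
rewrite (@gl_avgE _ _ (\det h ^- e *: lmul_poly h q)).
  by rewrite cayleyZ cayley_lmul // mulKf.
move=> g gU; rewrite fq ?unitmx_mul ?hU // /mx_eval mevalZ -!/(mx_eval _ _).
by rewrite mx_eval_lmul det_mulmx exprMn invfM [RHS]mulrCA mulrA.
Qed.

Definition rational f := exists e, rational_with e f.

Lemma rational_with_le e e' f : (e <= e')%N -> rational_with e f -> rational_with e' f.
Proof.
move=> ee [q fq]; exists (det_poly ^+ (e' - e) * q) => g gU.
rewrite fq // /mx_eval mevalM rmorphXn /= -!/(mx_eval _ _) mx_eval_det mulrA.
have dg : \det g != 0 by rewrite -unitfE -unitmxE.
congr (_ * _); rewrite -{1}(subnK ee) exprD invfM mulrAC mulVf ?mul1r //.
by rewrite expf_neq0.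
Qed.

(** The average is additive only for functions over the same power of the determinant; this supplies
    a common exponent for a finite family. *)
Lemma rational_family (I : finType) (F : I -> 'M[K]_n -> K) :
  (forall i, rational (F i)) -> exists e, forall i, rational_with e (F i).
Proof.
move=> FR; exists (\max_i projT1 (cid (FR i))) => i.
apply: (@rational_with_le (projT1 (cid (FR i)))); last by case: cid.
exact: (leq_bigmax_cond (F := fun i => projT1 (cid (FR i)))).
Qed.

Lemma rational_eq f1 f2 : (forall g, g \in unitmx -> f1 g = f2 g) ->
  rational f1 -> rational f2.
Proof. by move=> f12 [e fR]; exists e; apply: rational_with_eq fR. Qed.

Lemma rational_cst c : rational (fun=> c).
Proof. by exists 0%N; exact: rational_with_cst. Qed.

Lemma rationalM f1 f2 : rational f1 -> rational f2 -> rational (fun g => f1 g * f2 g).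
Proof.
move=> [e1 [q1 fq1]] [e2 [q2 fq2]]; exists (e1 + e2)%N, (q1 * q2) => g gU.
by rewrite fq1 // fq2 // /mx_eval mevalM exprD invfM mulrACA.
Qed.

Lemma rational_sum (I : finType) (F : I -> 'M[K]_n -> K) :
  (forall i, rational (F i)) -> rational (fun g => \sum_i F i g).
Proof. by move=> /rational_family[e FR]; exists e; apply: rational_with_sum. Qed.

Lemma rational_prod (I : Type) (s : seq I) (F : I -> 'M[K]_n -> K) :
  (forall i, rational (F i)) -> rational (fun g => \prod_(i <- s) F i g).
Proof.
move=> FR; elim: s => [|i s IH].
  by under eq_fun do rewrite big_nil; exact: rational_cst.
by under eq_fun do rewrite big_cons; exact: rationalM.
Qed.

Lemma rationalX e f : rational f -> rational (fun g => f g ^+ e).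
Proof.
move=> fR; elim: e => [|e IH]; first exact: rational_cst.
by under eq_fun do rewrite exprS; exact: rationalM.
Qed.

Lemma rational_meval N (p : {mpoly K[N]}) (F : 'I_N -> 'M[K]_n -> K) :
  (forall i, rational (F i)) -> rational (fun g => meval (F^~ g) p).
Proof.
move=> FR; elim/mpoly_ring_ind: p => [c|p q [e1 R1] [e2 R2]|i p Rp].
- by under eq_fun do rewrite mevalC; exact: rational_cst.
- under eq_fun do rewrite mevalD; exists (maxn e1 e2).
  by apply: rational_withD; [apply: rational_with_le R1|apply: rational_with_le R2];
    rewrite ?leq_maxl ?leq_maxr.
- by under eq_fun do rewrite mevalM mevalXU; exact: rationalM.
Qed.

Lemma rational_entry i j : rational (fun g => g i j).
Proof.
exists 0%N, (mXU (mxvec_index i j)) => g _.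
by rewrite /mx_eval mevalXU mxvecE expr0 invr1 mul1r.
Qed.

Lemma rational_detV : rational (fun g => (\det g)^-1).
Proof.
by exists 1%N, 1 => g _; rewrite /mx_eval meval1 mulr1.
Qed.

Lemma rational_det (m : nat) (F : 'M[K]_n -> 'M[K]_m) :
  (forall i j, rational (fun g => F g i j)) -> rational (fun g => \det (F g)).
Proof.
move=> FR; apply: rational_sum => s; apply: rationalM; first exact: rational_cst.
exact: rational_prod.
Qed.

Lemma rational_invmx_entry i j : rational (fun g => invmx g i j).
Proof.
apply: (@rational_eq (fun g => (\det g)^-1 * cofactor g j i)).
  by move=> g gU; rewrite /invmx gU !mxE.
apply: rationalM; first exact: rational_detV.
apply: rationalM; first exact: rational_cst.
apply: rational_det => k l; under eq_fun do rewrite !mxE.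
exact: rational_entry.
Qed.
End Averaging.

(** * Dickson's lemma for monomials of bounded degree in some of the variables *)

Section Dickson.

(** Choose repeatedly, beyond the last chosen index, an index at which [u] attains its minimum over
    the remaining tail. *)
Lemma nondecreasing_subsequence (u : nat -> nat) : exists2 phi : nat -> nat,
  {homo phi : a b / (a < b)%N} & forall a b, (a <= b)%N -> (u (phi a) <= u (phi b))%N.
Proof.
have minE m : {j | (m <= j)%N & forall i, (m <= i)%N -> (u j <= u i)%N}.
  apply/cid2; have exv : exists v, `[< exists2 j, (m <= j)%N & u j = v >].
    by exists (u m); apply/asboolP; exists m.
  have [v /asboolP[j mj <-] vmin] := ex_minnP exv; exists j => // i mi.
  by apply: vmin; apply/asboolP; exists i.
pose f m := s2val (minE m).
have fge m : (m <= f m)%N by exact: s2valP (minE m).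
have fmin m i : (m <= i)%N -> (u (f m) <= u i)%N.
  exact: s2valP' (minE m) i.
pose phi := fix phi a := if a is b.+1 then f (phi b).+1 else f 0%N.
have phi_lt : {homo phi : a b / (a < b)%N}.
  by apply: homo_ltn => [|a]; [exact: ltn_trans|exact: fge].
exists phi => //; apply: (@homo_leq _ (u \o phi) leq) => [a|b a c|a] /=;
  [exact: leqnn|exact: leq_trans|].
case: a => [|a]; first exact: fmin.
by apply: fmin; exact: leq_trans (fge _) (ltnW (fge _)).
Qed.

(** Subsequences are extracted for one coordinate after another; passing to a further subsequence
    keeps the coordinates already treated monotone. *)
Lemma dickson_sequence (I : finType) (u : nat -> I -> nat) :
  exists2 phi : nat -> nat, {homo phi : a b / (a < b)%N} &
    forall i a b, (a <= b)%N -> (u (phi a) i <= u (phi b) i)%N.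
Proof.
suff [phi phi_lt phi_le] : exists2 phi : nat -> nat, {homo phi : a b / (a < b)%N} &
    forall i, i \in enum I -> forall a b, (a <= b)%N -> (u (phi a) i <= u (phi b) i)%N.
  by exists phi => // i; apply: phi_le; rewrite mem_enum.
elim: (enum I) => [|i s [phi phi_lt phi_le]]; first by exists id.
have [psi psi_lt psi_le] := nondecreasing_subsequence (fun a => u (phi a) i).
exists (phi \o psi) => [a b /psi_lt/phi_lt //|j].
rewrite inE => /predU1P[-> //|js a b ab]; apply: phi_le => //.
by move: ab; rewrite leq_eqVlt => /predU1P[->//|/psi_lt/ltnW].
Qed.

Variables (N : nat) (Z : pred 'I_N).
Implicit Types (m : multinom N).

Definition degree_outside m := (\sum_(i | ~~ Z i) m i)%N.

(** Divisibility of monomials with a quotient that involves only variables in [Z]. *)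
Definition dominates_along m' m :=
  (forall i, (m' i <= m i)%N) /\ (forall i, ~~ Z i -> m' i = m i).

(* Bounding the degree outside [Z] makes [d - degree_outside] an additional
   natural coordinate, whose monotonicity forces equality outside [Z]. *)
Lemma dickson_along d (A : multinom N -> Prop) :
  (forall m, A m -> (degree_outside m <= d)%N) ->
  exists s : seq (multinom N), (forall m, m \in s -> A m) /\
    forall m, A m -> exists2 m', m' \in s & dominates_along m' m.
Proof.
move=> Ad; apply: contrapT => noS.
(* If no finite list suffices, every list in [A] misses some element of [A]. Iterating yields a
   sequence in which no term is dominated by an earlier one; lists not contained in [A] get a
   default value. *)
have nextE (s : seq (multinom N)) : {m | (forall m', m' \in s -> A m') ->
    A m /\ forall m', m' \in s -> ~ dominates_along m' m}.
  apply: cid; have [sA|sNA] := pselect (forall m', m' \in s -> A m'); last first.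
    by exists (@mnm0 N).
  have [m mP] : exists m, ~ (A m -> exists2 m', m' \in s & dominates_along m' m).
    by apply/existsNP => sP; apply: noS; exists s.
  exists m => _; move/not_implyP: mP => [Am /forall2NP mP]; split=> // m' m's.
  by case: (mP m').
pose next s := projT1 (nextE s).
have nextP s : (forall m', m' \in s -> A m') ->
    A (next s) /\ forall m', m' \in s -> ~ dominates_along m' (next s).
  exact: (projT2 (nextE s)).
pose S := fix S k := if k is l.+1 then next (S l) :: S l else [::].
have SA k : forall m', m' \in S k -> A m'.
  elim: k => //= k IH m'; rewrite inE => /predU1P[->|/IH//].
  by have [] := nextP _ IH.
have SS a b : (a < b)%N -> next (S a) \in S b.
  elim: b => // b IH; rewrite ltnS leq_eqVlt => /predU1P[->|/IH ab].
    by rewrite /= inE eqxx.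
  by rewrite /= inE ab orbT.
have Anext k : A (next (S k)) by apply: (SA k.+1); rewrite SS.
have ndom a b : (a < b)%N -> ~ dominates_along (next (S a)) (next (S b)).
  by move=> ab; have [_] := nextP _ (@SA b); apply; exact: SS.
pose u k (o : option 'I_N) := if o is Some i then next (S k) i
  else (d - degree_outside (next (S k)))%N.
have [phi phi_lt phi_le] := dickson_sequence u.
have := phi_lt 0%N 1%N isT; set a := phi 0%N; set b := phi 1%N => ab.
have le01 i : (next (S a) i <= next (S b) i)%N by apply: (phi_le (Some i) 0%N 1%N).
apply: (ndom a b ab); split=> // i Zi.
have := phi_le None 0%N 1%N isT; rewrite /= -/a -/b => /(leq_sub2l d).
rewrite !subKn ?Ad // => ba.
have := @leqif_sum _ (fun i => ~~ Z i) (fun i => next (S a) i == next (S b) i)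
  (fun i => next (S a) i) (fun i => next (S b) i) (fun i _ => leqif_eq (le01 i)).
move=> [le_ab]; rewrite eqn_leq le_ab -!/(degree_outside _) ba /=.
by move=> /esym /forall_inP /(_ i Zi) /eqP.
Qed.

End Dickson.

(** * Finite generation of modules over the polynomials in the variables of [Z] *)

Section Noetherian.
Variables (K : fieldType) (N : nat) (Z : pred 'I_N).
Implicit Types (p q c : {mpoly K[N]}) (S : {mpoly K[N]} -> Prop).

Definition poly_in c := forall m, m \in msupp c -> forall i, ~~ Z i -> m i = 0%N.

Lemma poly_inC a : poly_in (mpolyC N a).
Proof.
move=> m; rewrite msuppC; case: ifP => // _; rewrite inE => /eqP -> i _.
exact: mnm0E.
Qed.

Lemma poly_inM p q : poly_in p -> poly_in q -> poly_in (p * q).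
Proof.
move=> pZ qZ m /msuppM_le/allpairsP[[m1 m2] /= [m1p m2q ->]] i Zi.
by rewrite mnmDE (pZ _ m1p) ?(qZ _ m2q).
Qed.

Definition poly_span S p := exists2 L : seq ({mpoly K[N]} * {mpoly K[N]}),
  (forall x, x \in L -> poly_in x.1 /\ S x.2) & p = \sum_(x <- L) x.1 * x.2.

Lemma poly_span_gen S p : S p -> poly_span S p.
Proof.
move=> Sp; exists [:: (mpolyC N 1, p)]; last by rewrite big_seq1 mul1r.
by move=> x; rewrite inE => /eqP -> /=; split=> //; exact: poly_inC.
Qed.

Lemma poly_span0 S : poly_span S 0.
Proof. by exists [::]; rewrite ?big_nil. Qed.

Lemma poly_spanD S p q : poly_span S p -> poly_span S q -> poly_span S (p + q).
Proof.
move=> [L LS ->] [M MS ->]; exists (L ++ M); last by rewrite big_cat.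
by move=> x; rewrite mem_cat => /orP[/LS|/MS].
Qed.

Lemma poly_spanM S c p : poly_in c -> poly_span S p -> poly_span S (c * p).
Proof.
move=> cZ [L LS ->]; exists [seq (c * x.1, x.2) | x <- L].
  by move=> _ /mapP[x /LS[xZ xS] ->] /=; split=> //; exact: poly_inM.
by rewrite big_map mulr_sumr; apply: eq_bigr => x _; rewrite mulrA.
Qed.

Lemma poly_span_trans S S' p :
  (forall q, S q -> poly_span S' q) -> poly_span S p -> poly_span S' p.
Proof.
move=> SS' [L]; elim: L p => [|x L IH] p LS ->.
  by rewrite big_nil; exact: poly_span0.
rewrite big_cons; apply: poly_spanD.
  have [xZ xS] := LS x (mem_head _ _); apply: poly_spanM => //; exact: SS'.
by apply: IH => // y yL; apply: LS; rewrite inE yL orbT.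
Qed.

(** Coefficients involve only variables in [Z], so multiplying by them does not change the degree in
    the other variables. *)
Lemma poly_span_degree_outside d S p : (forall q, S q ->
    forall m, m \in msupp q -> (degree_outside Z m <= d)%N) ->
  poly_span S p -> forall m, m \in msupp p -> (degree_outside Z m <= d)%N.
Proof.
move=> Sd [L]; elim: L p => [|[c q] L IH] p LS ->.
  by rewrite big_nil => m; rewrite msupp0.
rewrite big_cons => m /msuppD_le; rewrite mem_cat => /orP[|]; last first.
  by apply: IH => // y yL; apply: LS; rewrite inE yL orbT.
have [cZ qS] := LS _ (mem_head _ _).
move=> /msuppM_le/allpairsP[[m1 m2] /= [m1c m2q ->]].
suff -> : degree_outside Z (mnm_add m1 m2) = degree_outside Z m2 by exact: Sd m2q.
by apply: eq_bigr => i Zi; rewrite mnmDE (cZ _ m1c).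
Qed.

(* Cancelling leading monomials against finitely many generators whose leading
   monomials dominate all others, as in Gordan's proof of the basis theorem. *)
Lemma poly_span_noetherian d S : (forall q, S q ->
    forall m, m \in msupp q -> (degree_outside Z m <= d)%N) ->
  exists2 s : seq {mpoly K[N]}, (forall p, p \in s -> S p) &
    forall p, S p -> poly_span (fun q => q \in s) p.
Proof.
move=> Sd; pose A m := exists p, [/\ poly_span S p, p != 0 & mlead p = m].
have [|s [sA sdom]] := @dickson_along _ Z d A.
  move=> m [p [pS p0 <-]]; apply: (poly_span_degree_outside Sd pS).
  exact: mlead_supp.
have gE m : {g | m \in s -> [/\ poly_span S g, g != 0 & mlead g = m]}.
  apply: cid; have [ms|ms] := boolP (m \in s); last by exists 0.
  by have [g gP] := sA m ms; exists g.
pose g m := projT1 (gE m).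
have gP m : m \in s -> [/\ poly_span S (g m), g m != 0 & mlead (g m) = m].
  exact: (projT2 (gE m)).
have span_g p : poly_span S p -> poly_span (fun q => exists2 m, m \in s & q = g m) p.
  move: {2}(mlead p) (erefl (mlead p)) => l; elim/(well_founded_ind (@ltom_wf N)): l p.
  move=> l IH p pl pS; have [->|p0] := eqVneq p 0; first exact: poly_span0.
  have [|m ms [m_le m_eq]] := sdom l; first by exists p.
  have [gS g0 gl] := gP m ms.
  pose t := mnm_sub l m; pose a := mleadc p / mleadc (g m).
  pose c : {mpoly K[N]} := a *: mX t.
  have cZ : poly_in c.
    move=> m1 /msuppZ_le; rewrite msuppX inE => /eqP -> i Zi.
    by rewrite mnmBE m_eq // subnn.
  have tm : mnm_add t m = l by rewrite submK //; apply/mnm_lepP.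
  have a0 : a != 0 by rewrite mulf_neq0 ?invr_eq0 ?mleadc_eq0.
  have cl : mlead (c * g m) = l.
    rewrite -scalerAl mleadZ // mleadM ?gl ?mleadXm //.
    apply/eqP => /(congr1 (mcoeff t))/eqP.
    by rewrite mcoeffX eqxx mcoeff0 oner_eq0.
  pose p' := p - c * g m.
  have -> : p = c * g m + p' by rewrite addrC subrK.
  apply: poly_spanD; first by apply: poly_spanM => //; apply: poly_span_gen; exists m.
  have p'S : poly_span S p'.
    rewrite /p' -mulNr; apply: poly_spanD => //; apply: poly_spanM => //.
    by rewrite -mulN1r -mpolyC1 -mpolyCN; apply: poly_inM => //; exact: poly_inC.
  have [->|p'0] := eqVneq p' 0; first exact: poly_span0.
  apply: (IH (mlead p')) => //; rewrite lt_neqAle; apply/andP; split; last first.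
    by have := mleadB_le p (c * g m); rewrite pl cl joinxx.
  apply: contra_neq p'0 => p'l; apply/eqP; rewrite -mleadc_eq0 p'l mcoeffB subr_eq0.
  have -> : mcoeff l (c * g m) = a * mleadc (g m).
    by rewrite -scalerAl mcoeffZ [mX t * _]mulrC -tm mcoeffMX gl.
  by rewrite /a divfK ?mleadc_eq0 // pl.
(* The [g m] are only known to lie in the span of [S]; the finitely many elements of [S] occurring
   in them are the generators sought. *)
have LE m : {L : seq ({mpoly K[N]} * {mpoly K[N]}) | m \in s ->
    (forall x, x \in L -> poly_in x.1 /\ S x.2) /\ g m = \sum_(x <- L) x.1 * x.2}.
  apply: cid; have [ms|ms] := boolP (m \in s); last by exists [::].
  by have [[L L1 L2] _ _] := gP m ms; exists L.
pose L m := projT1 (LE m).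
have LP m : m \in s ->
    (forall x, x \in L m -> poly_in x.1 /\ S x.2) /\ g m = \sum_(x <- L m) x.1 * x.2.
  exact: (projT2 (LE m)).
exists [seq x.2 | m <- s, x <- L m].
  by move=> _ /allpairsPdep[m [x [ms xL ->]]]; have [/(_ x xL)[]] := LP m ms.
move=> p Sp; apply: (poly_span_trans _ (span_g p (poly_span_gen Sp))).
move=> _ [m ms ->]; have [L1 L2] := LP m ms; exists (L m) => // x xL.
split; first by have [] := L1 x xL.
by apply/allpairsPdep; exists m, x.
Qed.

End Noetherian.

(** * Entrywise averages of matrix-valued functions *)

Section MatrixAveraging.
Variables (K : numFieldType) (n a b : nat) (e : nat) (F : 'M[K]_n -> 'M[K]_(a, b)).
Hypothesis FR : forall i j, rational_with e (fun g => F g i j).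

Definition gl_avg_mx a b (F : 'M[K]_n -> 'M[K]_(a, b)) : 'M[K]_(a, b) :=
  \matrix_(i, j) gl_avg e (fun g => F g i j).

Lemma gl_avg_mulmxl c (A : 'M[K]_(c, a)) :
  gl_avg_mx (fun g => A *m F g) = A *m gl_avg_mx F.
Proof.
apply/matrixP => i j; rewrite !mxE; under eq_fun do rewrite mxE.
rewrite gl_avg_sum => [|k]; last exact: rational_withZ.
by apply: eq_bigr => k _; rewrite gl_avgZ // mxE.
Qed.

Lemma gl_avg_mulmxr c (B : 'M[K]_(b, c)) :
  gl_avg_mx (fun g => F g *m B) = gl_avg_mx F *m B.
Proof.
apply/matrixP => i j; rewrite !mxE.
under eq_fun do (rewrite mxE; under eq_bigr do rewrite mulrC).
rewrite gl_avg_sum => [|k]; last exact: rational_withZ.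
by apply: eq_bigr => k _; rewrite gl_avgZ // mxE mulrC.
Qed.

Lemma gl_avg_mx_lmul h : h \in unitmx ->
  gl_avg_mx (fun g => F (h *m g)) = gl_avg_mx F.
Proof.
by move=> hU; apply/matrixP => i j; rewrite !mxE (gl_avg_lmul hU (FR i j)).
Qed.

Lemma gl_avg_mx_cst (A : 'M[K]_(a, b)) : gl_avg_mx (fun=> A) = A.
Proof. by apply/matrixP => i j; rewrite !mxE gl_avg_cst. Qed.

Lemma eq_gl_avg_mx (G : 'M[K]_n -> 'M[K]_(a, b)) :
  (forall g, g \in unitmx -> F g = G g) -> gl_avg_mx F = gl_avg_mx G.
Proof.
by move=> FG; apply/matrixP => i j; rewrite !mxE; apply: eq_gl_avg => g /FG ->.
Qed.

End MatrixAveraging.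

Lemma rational_with_sum_mx (K : numFieldType) n a b e (I : Type) (s : seq I)
    (F : I -> 'M[K]_n -> 'M[K]_(a, b)) :
  (forall i j l, rational_with e (fun g => F i g j l)) ->
  forall j l, rational_with e (fun g => (\sum_(i <- s) F i g) j l).
Proof.
by move=> FR j l; under eq_fun do rewrite summxE; exact: rational_with_sum.
Qed.

Lemma gl_avg_mx_sum (K : numFieldType) n a b e (I : Type) (s : seq I)
    (F : I -> 'M[K]_n -> 'M[K]_(a, b)) :
  (forall i j l, rational_with e (fun g => F i g j l)) ->
  gl_avg_mx e (fun g => \sum_(i <- s) F i g) = \sum_(i <- s) gl_avg_mx e (F i).
Proof.
move=> FR; apply/matrixP => j l; rewrite mxE summxE.
under eq_fun do rewrite summxE.
by rewrite gl_avg_sum //; apply: eq_bigr => i _; rewrite mxE.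
Qed.

(** * Equivariant projections onto invariant subspaces *)

Section Representations.
Variables (K : numFieldType) (n : nat).
Implicit Types (V W : tensor_bundle K n) (g h : 'M[K]_n).

Lemma invmx_mul g h : g \in unitmx -> h \in unitmx ->
  invmx (g *m h) = invmx h *m invmx g.
Proof.
move=> gU hU; have ghU : g *m h \in unitmx by rewrite unitmx_mul gU.
by apply: (can_inj (mulmxK ghU)); rewrite mulVmx // mulmxA mulmxKV // mulVmx.
Qed.

Lemma fibre_actKV V g : g \in unitmx -> V g *m V (invmx g) = 1%:M.
Proof. by move=> gU; rewrite -fibre_actM ?unitmx_inv // mulmxV // fibre_act1. Qed.

Lemma fibre_actVK V g : g \in unitmx -> V (invmx g) *m V g = 1%:M.
Proof. by move=> gU; rewrite -fibre_actM ?unitmx_inv // mulVmx // fibre_act1. Qed.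

Lemma rational_fibre V i j : rational (fun g => V g i j).
Proof.
have [e [P VP]] := fibre_act_rational V; exists e, (P i j) => g gU.
by rewrite VP // !mxE.
Qed.

Lemma rational_fibreV V i j : rational (fun g => V (invmx g) i j).
Proof.
have [e [P VP]] := fibre_act_rational V.
apply: (@rational_eq _ _ (fun g => \det g ^+ e * meval (mxvec (invmx g) 0) (P i j))).
  by move=> g gU; rewrite VP ?unitmx_inv // !mxE det_inv exprVn invrK.
apply: rationalM.
  by apply: rationalX; apply: rational_det => k l; exact: rational_entry.
apply: (@rational_meval _ _ _ (P i j) (fun t g => mxvec (invmx g) 0 t)) => t.
case/mxvec_indexP: t => k l; under eq_fun do rewrite mxvecE.
exact: rational_invmx_entry.
Qed.

(** [M] is a projection onto an invariant subspace, and [X] is the average of its conjugates. Each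
    conjugate maps into this subspace and is the identity on it, and both properties survive
    averaging. *)
Lemma equivariant_projection V (M : 'M[K]_(fdim V)) : M *m M = M ->
  (forall g, g \in unitmx -> M *m (V g *m M) = V g *m M) ->
  exists X : 'M[K]_(fdim V), [/\ M *m X = X, X *m M = M &
    forall g, g \in unitmx -> X *m V g = V g *m X].
Proof.
move=> MM MV; pose F g := V g *m M *m V (invmx g).
have [|e FR] := @rational_family _ _ ('I_(fdim V) * 'I_(fdim V))%type
    (fun ij g => F g ij.1 ij.2).
  move=> [i j] /=; rewrite /F; under eq_fun do rewrite mxE.
  apply: rational_sum => k; apply: rationalM; last exact: rational_fibreV.
  under eq_fun do rewrite mxE.
  apply: rational_sum => l; apply: rationalM; first exact: rational_fibre.
  exact: rational_cst.
have {}FR i j : rational_with e (fun g => F g i j) by exact: (FR (i, j)).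
exists (gl_avg_mx e F); split=> [||h hU].
- rewrite -gl_avg_mulmxl //; apply: eq_gl_avg_mx => g gU.
  by rewrite /F !mulmxA -[M *m V g *m M]mulmxA MV.
- rewrite -gl_avg_mulmxr // -[RHS](gl_avg_mx_cst n e); apply: eq_gl_avg_mx => g gU.
  by rewrite /F -!mulmxA MV ?unitmx_inv // mulmxA fibre_actKV // mul1mx.
(* Translating the variable of the average by [h] conjugates the average by [V h]. *)
have XE : gl_avg_mx e F = V h *m gl_avg_mx e F *m V (invmx h).
  rewrite -{1}(gl_avg_mx_lmul FR hU) -gl_avg_mulmxl // -gl_avg_mulmxr.
    apply: eq_gl_avg_mx => g gU; rewrite /F invmx_mul // !fibre_actM ?unitmx_inv //.
    by rewrite !mulmxA.
  move=> i j; under eq_fun do rewrite mxE.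
  by apply: rational_with_sum => k; exact: rational_withZ.
by rewrite {1}XE -!mulmxA fibre_actVK // mulmx1.
Qed.

End Representations.

(** A left inverse of [io] and a right inverse of [pr] cancel the outer factors of the idempotent
    identity. *)
Lemma mulmx_full_free_idem (K : fieldType) m r (io : 'M[K]_(m, r)) (pr : 'M[K]_(r, m)) :
  row_full io -> row_free pr -> io *m pr *m (io *m pr) = io *m pr -> pr *m io = 1%:M.
Proof.
move=> /row_fullP[C Cio] /row_freeP[B prB] /(congr1 (fun A => C *m A *m B)) /=.
by rewrite !mulmxA Cio mul1mx -!mulmxA prB mulmx1.
Qed.

Lemma idempotent_factor (K : fieldType) m (X : 'M[K]_m) : X *m X = X ->
  exists (io : 'M[K]_(m, \rank X)) (pr : 'M[K]_(\rank X, m)),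
    io *m pr = X /\ pr *m io = 1%:M.
Proof.
move=> XX; exists (col_base X), (row_base X); rewrite mulmx_base; split=> //.
apply: mulmx_full_free_idem; rewrite ?col_base_full ?row_base_free //.
by rewrite mulmx_base.
Qed.

(** * Complete reducibility of tensor bundles *)

Section Decomposition.
Variables (K : numFieldType) (n : nat).
Implicit Types (V W : tensor_bundle K n).

Section Summand.
Variables (W : tensor_bundle K n) (r : nat).
Variables (io : 'M[K]_(fdim W, r)) (pr : 'M[K]_(r, fdim W)).
Hypothesis proj_inj : pr *m io = 1%:M.
Hypothesis equiv : forall g, g \in unitmx -> io *m pr *m W g = W g *m (io *m pr).

(** The action on the image of the equivariant idempotent [io *m pr], in the coordinates given by
    [pr]. *)
Definition summand_act g := pr *m W g *m io.

Lemma summand_act1 : summand_act 1%:M = 1%:M.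
Proof. by rewrite /summand_act fibre_act1 mulmx1. Qed.

Lemma summand_proj g : g \in unitmx -> pr *m W g = summand_act g *m pr.
Proof.
by move=> gU; rewrite /summand_act -!mulmxA -equiv // !mulmxA proj_inj mul1mx.
Qed.

Lemma summand_actM : {in unitmx &, forall g h,
  summand_act (g *m h) = summand_act g *m summand_act h}.
Proof.
move=> g h gU hU; rewrite {2}/summand_act !mulmxA -summand_proj //.
by rewrite -[pr *m W g *m W h]mulmxA -fibre_actM.
Qed.

Lemma summand_act_rational : exists (e : nat) (P : 'M[{mpoly K[n * n]}]_r),
  forall g, g \in unitmx ->
    summand_act g = (\det g) ^- e *: map_mx (meval (mxvec g 0)) P.
Proof.
have [e [P WP]] := fibre_act_rational W.
pose C p q (A : 'M[K]_(p, q)) := map_mx (@mpolyC (n * n) K) A.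
exists e, (C _ _ pr *m P *m C _ _ io) => g gU.
have CK p q (A : 'M[K]_(p, q)) : map_mx (meval (mxvec g 0)) (C _ _ A) = A.
  by apply/matrixP => i j; rewrite !mxE mevalC.
by rewrite !map_mxM !CK /summand_act WP // -scalemxAr -scalemxAl.
Qed.

Definition summand_bundle := TensorBundle summand_act1 summand_actM summand_act_rational.

End Summand.

(** The equivariant [pr i] carry natural operations to the summands; the [io i] recombine the
    results linearly. *)
Definition decomposable_into (W : tensor_bundle K n) :=
  exists (I : finType) (Wi : I -> tensor_bundle K n)
    (io : forall i, 'M[K]_(fdim W, fdim (Wi i)))
    (pr : forall i, 'M[K]_(fdim (Wi i), fdim W)),
  [/\ forall i, indecomposable (Wi i),
      forall i g, g \in unitmx -> pr i *m W g = Wi i g *m pr i &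
      \sum_i io i *m pr i = 1%:M].

Lemma decomposable_summand W r (io : 'M[K]_(fdim W, r)) (pr : 'M[K]_(r, fdim W))
    (pr_io : pr *m io = 1%:M)
    (eq_io : forall g, g \in unitmx -> io *m pr *m W g = W g *m (io *m pr)) :
  decomposable_into (summand_bundle pr_io eq_io) ->
  exists (I : finType) (Wi : I -> tensor_bundle K n)
    (ioI : forall i, 'M[K]_(fdim W, fdim (Wi i)))
    (prI : forall i, 'M[K]_(fdim (Wi i), fdim W)),
  [/\ forall i, indecomposable (Wi i),
      forall i g, g \in unitmx -> prI i *m W g = Wi i g *m prI i &
      \sum_i ioI i *m prI i = io *m pr].
Proof.
move=> [I [WI]] /= [ioI [prI [indI eqI sumI]]].
exists I, WI, (fun i => io *m ioI i), (fun i => prI i *m pr); split=> // [i g gU|].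
  by rewrite -mulmxA (summand_proj pr_io) // mulmxA eqI // -mulmxA.
rewrite -[io in RHS]mulmx1 -sumI mulmx_sumr mulmx_suml.
by apply: eq_bigr => i _; rewrite !mulmxA.
Qed.

(** An idempotent other than the identity has rank below the dimension. This applies to both [X] and
    its complement, so induction decomposes both images. *)
Lemma decomposable_add W (X : 'M[K]_(fdim W)) : X *m X = X ->
  (forall g, g \in unitmx -> X *m W g = W g *m X) -> X != 0 -> X != 1%:M ->
  (forall W', (fdim W' < fdim W)%N -> decomposable_into W') -> decomposable_into W.
Proof.
move=> XX XW X0 X1 IH; pose Y := 1%:M - X.
have YY : Y *m Y = Y.
  by rewrite /Y mulmxBl mul1mx mulmxBr mulmx1 XX subrr subr0.
have YW g : g \in unitmx -> Y *m W g = W g *m Y.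
  by move=> gU; rewrite mulmxBl mulmxBr mul1mx mulmx1 XW.
have rank_lt (Z : 'M[K]_(fdim W)) : Z *m Z = Z -> Z != 1%:M -> (\rank Z < fdim W)%N.
  move=> ZZ; apply: contraR; rewrite -leqNgt => rZ.
  have ZU : Z \in unitmx.
    by rewrite -row_full_unit /row_full eqn_leq rank_leq_col.
  by apply/eqP; apply: (can_inj (mulmxK ZU)); rewrite ZZ mul1mx.
have Y1 : Y != 1%:M.
  by apply: contra_neq X0 => Y1; rewrite -[X](subKr 1%:M) -/Y Y1 subrr.
have [ioX [prX [eX pX]]] := idempotent_factor XX.
have [ioY [prY [eY pY]]] := idempotent_factor YY.
have XW' g : g \in unitmx -> ioX *m prX *m W g = W g *m (ioX *m prX).
  by rewrite eX; exact: XW.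
have YW' g : g \in unitmx -> ioY *m prY *m W g = W g *m (ioY *m prY).
  by rewrite eY; exact: YW.
have [I [WI [ioI [prI [indI eqI sumI]]]]] :=
  decomposable_summand (IH (summand_bundle pX XW') (rank_lt X XX X1)).
have [J [WJ [ioJ [prJ [indJ eqJ sumJ]]]]] :=
  decomposable_summand (IH (summand_bundle pY YW') (rank_lt Y YY Y1)).
pose WIJ (s : I + J) := match s with inl i => WI i | inr j => WJ j end.
exists (I + J)%type, WIJ.
exists (fun s => match s return 'M[K]_(fdim W, fdim (WIJ s)) with
  inl i => ioI i | inr j => ioJ j end).
exists (fun s => match s return 'M[K]_(fdim (WIJ s), fdim W) with
  inl i => prI i | inr j => prJ j end).
split=> [[i|j]|[i|j] g gU|]; [exact: indI|exact: indJ|exact: eqI|exact: eqJ|].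
by rewrite big_sumType /= sumI sumJ eX eY addrC subrK.
Qed.

Lemma bundle_decomposition W : decomposable_into W.
Proof.
have [m] := ubnP (fdim W); elim: m W => // m IH W; rewrite ltnS => Wm.
have [W0|W0] := posnP (fdim W).
  exists void, (fun v : void => match v with end).
  exists (fun v : void => match v with end), (fun v : void => match v with end).
  split=> [[]|[]|]; apply/matrixP => i; move: (ltn_ord i); by rewrite [X in (_ < X)%N]W0.
have [indW|nindW] := pselect (indecomposable W).
  exists unit, (fun=> W), (fun=> 1%:M), (fun=> 1%:M); split=> [//|_ g _|].
    by rewrite mulmx1 mul1mx.
  by rewrite (big_pred1 tt) ?mulmx1 // => -[].
have [U /not_implyP[UW /not_orP[U0 Uf]]] : exists U : {vspace 'cV[K]_(fdim W)},
    ~ ((forall g u, g \in unitmx -> u \in U -> W g *m u \in U) ->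
      U = 0%VS \/ U = fullv).
  by apply/existsNP => indW; apply: nindW; split.
(* The matrix of a linear projection onto the proper invariant subspace [U], not yet equivariant. *)
pose M : 'M[K]_(fdim W) := \matrix_(i, j) projv U (delta_mx j 0) i 0.
have MP (u : 'cV_(fdim W)) : M *m u = projv U u.
  rewrite [u in RHS]matrix_sum_delta; under [in RHS]eq_bigr do rewrite big_ord1.
  rewrite linear_sum; apply/colP => i; rewrite mxE summxE; apply: eq_bigr => j _.
  by rewrite linearZ !mxE mulrC.
have MU (u : 'cV_(fdim W)) : M *m u \in U by rewrite MP memv_proj.
have MI (u : 'cV_(fdim W)) : u \in U -> M *m u = u by rewrite MP; exact: projv_id.
have col_ext p q (A B : 'M[K]_(p, q)) : (forall u : 'cV_q, A *m u = B *m u) -> A = B.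
  move=> AB; apply/matrixP => i j; have := AB (delta_mx j 0); rewrite -!colE.
  by move=> /colP /(_ i); rewrite !mxE.
have [||X [MX XM XW]] := @equivariant_projection _ _ W M.
- by apply: col_ext => u; rewrite -mulmxA MI.
- by move=> g gU; apply: col_ext => u; rewrite -!mulmxA MI // UW.
apply: (@decomposable_add W X) => //.
- by rewrite -{2}MX mulmxA XM MX.
- apply/eqP => X0; apply: U0; apply/eqP; rewrite -subv0; apply/subvP => u /MI <-.
  by rewrite -XM X0 !mul0mx mem0v.
- apply/eqP => X1; apply: Uf; apply/eqP; rewrite eqEsubv subvf /=; apply/subvP => u _.
  by rewrite -[u]mul1mx -X1 -MX -mulmxA.
- by move=> W' W'W; apply: IH; apply: leq_trans W'W _.
Qed.

End Decomposition.

(** * Chain rule and linear changes of coordinates *)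

Section ChainRule.
Local Open Scope classical_set_scope.
Variables (K : numFieldType) (n : nat).
Implicit Types (f : 'cV[K]_n -> K^o) (x : 'cV[K]_n) (A : 'M[K]_n).

Lemma differentiable_col (V : normedModType K) m (F : V -> 'cV[K]_m) (x : V) :
  (forall i, differentiable (fun z => F z i 0 : K^o) x) -> differentiable F x.
Proof.
move=> Fd; rewrite (_ : F = \sum_(i < m) (fun z => (F z i 0 : K^o) *: delta_mx i 0)).
  by apply: differentiable_sum => i; exact: differentiableZl.
apply/funext => z; rewrite fct_sumE [LHS]matrix_sum_delta.
by apply: eq_bigr => i _; rewrite big_ord1.
Qed.

Lemma diff_coord (V : normedModType K) m (F : V -> 'cV[K]_m) (x v : V) i :
  differentiable F x -> 'd (fun z => F z i 0 : K^o) x v = ('d F x v) i 0.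
Proof.
move=> dF.
pose c : 'cV[K]_m -> K^o := fun M => M i 0.
have clin : linear c by move=> a u w; rewrite /c !mxE.
pose cM := GRing.isLinear.Build _ _ _ _ _ clin.
pose cL : {linear 'cV[K]_m -> K^o} := HB.pack c cM.
have cc : continuous cL by exact: coord_continuous.
have dc : differentiable c (F x) by exact: (@linear_differentiable _ _ _ cL).
rewrite (_ : (fun z => _) = c \o F) // diff_comp //=.
by rewrite (@diff_lin _ _ _ cL).
Qed.

Lemma partial_comp m f (F : 'cV[K]_m -> 'cV[K]_n) (x : 'cV[K]_m) i :
  (forall j, differentiable (fun z => F z j 0 : K^o) x) -> differentiable f (F x) ->
  partial i (f \o F) x = \sum_j partial j f (F x) * jacmx F x j i.
Proof.
move=> Fd fd; have dF := differentiable_col Fd.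
rewrite /partial deriveE; last exact: differentiable_comp.
rewrite diff_comp //= [X in 'd f _ X]matrix_sum_delta linear_sum; apply: eq_bigr => j _.
by rewrite big_ord1 linearZ /= -diff_coord // mxE /partial !deriveE // mulrC.
Qed.

Lemma differentiable_mulmx_coord A x j :
  differentiable (fun z : 'cV[K]_n => (A *m z) j 0 : K^o) x.
Proof.
rewrite (_ : (fun z => _) = \sum_(k < n) (A j k *: (fun z : 'cV[K]_n => z k 0 : K^o))).
  by apply: differentiable_sum => k; apply: differentiableZ; exact: differentiable_coord.
by apply/funext => z; rewrite fct_sumE mxE.
Qed.

Lemma mulmx_continuous A : continuous (fun z : 'cV[K]_n => A *m z).
Proof.
move=> x; apply: differentiable_continuous.
by apply: differentiable_col => j; exact: differentiable_mulmx_coord.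
Qed.

Lemma jacmx_mulmx A x : jacmx (fun z => A *m z) x = A.
Proof.
have dA : differentiable (mulmx A : 'cV[K]_n -> 'cV[K]_n) x.
  by apply: differentiable_col => j; exact: differentiable_mulmx_coord.
apply/matrixP => i j; rewrite mxE /partial deriveE; last first.
  exact: differentiable_mulmx_coord.
rewrite (diff_coord _ _ dA) diff_lin; last exact: mulmx_continuous.
by rewrite /= -colE mxE.
Qed.

(** By induction on [r]: the partial derivatives of the composite are constant combinations of the
    partial derivatives of [f] composed with the same linear map. *)
Lemma dsmooth_mulmx r (U : set 'cV[K]_n) f A : open U -> dsmooth r U f ->
  dsmooth r ((fun x => A *m x) @^-1` U) (fun x => f (A *m x)).
Proof.
move=> oU; have oV : open ((fun x => A *m x) @^-1` U).
  by apply: open_comp => // x _; exact: mulmx_continuous.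
have dcomp g x : differentiable g (A *m x) -> differentiable (fun x => g (A *m x)) x.
  move=> dg; apply: (@differentiable_comp _ _ _ _ (mulmx A) g) => //.
  by apply: differentiable_col => j; exact: differentiable_mulmx_coord.
elim: r f => [|r IH] f fU.
  by case=> // _ x Ux; apply: dcomp; exact: (fU [::]).
apply: dsmoothS => [x Ux|i]; first by apply: dcomp; exact: (fU [::]).
apply: dsmooth_eq (_ : dsmooth r _ (fun x => \sum_j partial j f (A *m x) * A j i)) => //.
  move=> x Ux; rewrite -[RHS]/(partial i (f \o mulmx A) x) partial_comp.
  - by apply: eq_bigr => j _; rewrite jacmx_mulmx.
  - by move=> j; exact: differentiable_mulmx_coord.
  - exact: (fU [::]).
apply: dsmooth_sum => // j; apply: dsmoothM => //; last exact: dsmooth_cst.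
by apply: IH; exact: dsmooth_partial.
Qed.

Lemma dsmooth_coord r (U : set 'cV[K]_n) j : open U ->
  dsmooth r U (fun z : 'cV[K]_n => z j 0 : K^o).
Proof.
move=> oU; case: r => [|r]; first by case=> // _ x _; exact: differentiable_coord.
apply: dsmoothS => [x _|i]; first exact: differentiable_coord.
apply: dsmooth_eq (@dsmooth_cst _ _ r U ((1%:M : 'M[K]_n) j i)) => // x _.
have := congr1 (fun M : 'M[K]_n => M j i) (jacmx_mulmx 1%:M x).
by rewrite mxE => <-; congr (partial i _ x); apply/funext => z; rewrite mul1mx.
Qed.

Lemma smooth_at_mulmx A x : smooth_at (fun z => A *m z) x.
Proof.
have : smooth_on setT (fun z => A *m z).
  apply/smooth_onP => r i.
  rewrite -(preimage_setT (fun x : 'cV[K]_n => A *m x)).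
  apply: (@dsmooth_mulmx _ _ (fun z => z i 0)); first exact: openT.
  exact: dsmooth_coord openT.
exact.
Qed.

Lemma local_diffeo_mulmx A : A \in unitmx ->
  local_diffeo (fun x => A *m x) (fun x => invmx A *m x).
Proof.
move=> AU; split; rewrite ?mulmx0 //; apply: (@filterE _ (nbhs (0 : 'cV[K]_n))) => x.
- exact: smooth_at_mulmx.
- exact: smooth_at_mulmx.
- by rewrite mulKmx.
- by rewrite mulKVmx.
Qed.

(** The chain rule applied to G o F = id near 0. *)
Lemma local_diffeo_jac_unit (F G : 'cV[K]_n -> 'cV[K]_n) :
  local_diffeo F G -> jacmx F 0 \in unitmx.
Proof.
move=> FG; suff /mulmx1_unit[] : jacmx G 0 *m jacmx F 0 = 1%:M by [].
have Fd j : differentiable (fun z => F z j 0 : K^o) 0.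
  exact: (nbhs_singleton (ld_smooth FG) [::]).
have Gd j : differentiable (fun z => G z j 0 : K^o) (F 0).
  by rewrite (ld_fix FG); exact: (nbhs_singleton (ld_smoothV FG) [::]).
apply/matrixP => i j; rewrite mxE.
have -> : 1%:M i j = partial j ((fun z => G z i 0) \o F) 0.
  have := congr1 (fun M : 'M[K]_n => M i j) (jacmx_mulmx 1%:M 0).
  rewrite mxE => <-; apply: near_eq_derive.
  by apply: filterS (ld_K FG) => z /= ->; rewrite mul1mx.
rewrite partial_comp //; apply: eq_bigr => k _.
by rewrite (ld_fix FG) mxE.
Qed.

End ChainRule.

Section LinearPushforward.
Local Open Scope classical_set_scope.
Variables (K : numFieldType) (n : nat) (V : tensor_bundle K n).

Definition mx_pushforward (g : 'M[K]_n) (v : 'cV[K]_n -> 'cV[K]_(fdim V)) :=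
  @Defs.pushforward K n V (fun x => g *m x) (fun x => invmx g *m x) v.

Lemma mx_pushforwardE g v y : mx_pushforward g v y = V g *m v (invmx g *m y).
Proof. by rewrite /mx_pushforward /Defs.pushforward jacmx_mulmx. Qed.

End LinearPushforward.

(** * Averaging linear maps on tensors into natural ones *)

Section TensorAveraging.
Variables (K : numFieldType) (n : nat) (W1 V W2 : tensor_bundle K n) (p : nat).
Local Notation T := {ffun tens_index W1 V p -> K^o}.
Implicit Types (t : T) (g h : 'M[K]_n).

Definition tens_kernel g (x y : tens_index W1 V p) : K :=
  W1 g x.1 y.1 * \prod_q V g (x.2 q) (y.2 q).

Lemma tens_actE g t x : tens_act g t x = \sum_y tens_kernel g x y * t y.
Proof. by rewrite ffunE. Qed.

Lemma tens_act_linear g : linear (@tens_act _ _ W1 V p g : T -> T).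
Proof.
move=> c t u; apply/ffunP => x; rewrite tens_actE !ffunE scaler_sumr -big_split.
by apply: eq_bigr => y _; rewrite !ffunE mulrDr -scalerAr.
Qed.

Lemma tens_kernelM g h x y : g \in unitmx -> h \in unitmx ->
  tens_kernel (g *m h) x y = \sum_z tens_kernel g x z * tens_kernel h z y.
Proof.
move=> gU hU; rewrite /tens_kernel !fibre_actM // mxE.
under [X in _ * X]eq_bigr do rewrite mxE.
rewrite (bigA_distr_bigA (fun q j => V g (x.2 q) j * V h j (y.2 q))).
rewrite mulr_suml; under eq_bigr do rewrite mulr_sumr.
rewrite pair_big; apply: eq_bigr => -[i f] _ /=.
by rewrite big_split mulrACA.
Qed.

Lemma tens_actM g h t : g \in unitmx -> h \in unitmx ->
  tens_act (g *m h) t = tens_act g (tens_act h t).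
Proof.
move=> gU hU; apply/ffunP => x; rewrite !tens_actE.
under [RHS]eq_bigr do rewrite tens_actE mulr_sumr.
rewrite exchange_big; apply: eq_bigr => y _; rewrite tens_kernelM // mulr_suml.
by apply: eq_bigr => z _; rewrite mulrA.
Qed.

Lemma tens_act_perm g s t : tens_act g (tens_perm s t) = tens_perm s (tens_act g t).
Proof.
apply/ffunP => x; rewrite tens_actE ffunE tens_actE.
pose sh (y : tens_index W1 V p) : tens_index W1 V p := (y.1, [ffun q => y.2 (s q)]).
pose sh' (y : tens_index W1 V p) : tens_index W1 V p :=
  (y.1, [ffun q => y.2 ((s^-1)%g q)]).
rewrite [RHS](reindex_onto sh sh') => [|[i f] _]; last first.
  by congr (_, _); apply/ffunP => q; rewrite !ffunE /= permK.
apply: eq_big => [[i f]|[i f] _].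
  by apply/esym/eqP; congr (_, _); apply/ffunP => q; rewrite !ffunE /= permKV.
rewrite ffunE /tens_kernel /=; congr (_ * _ * _).
by rewrite (reindex_inj (@perm_inj _ s)) /=; apply: eq_bigr => q _; rewrite !ffunE.
Qed.

Lemma tens_act_pow g w v :
  tens_act g (tens_pow p w v) = tens_pow p (W1 g *m w) (V g *m v) :> T.
Proof.
apply/ffunP => x; rewrite tens_actE [RHS]ffunE mxE.
under [X in _ * X]eq_bigr do rewrite mxE.
rewrite (bigA_distr_bigA (fun q j => V g (x.2 q) j * v j 0)) mulr_suml.
under [RHS]eq_bigr do rewrite mulr_sumr.
rewrite pair_big; apply: eq_bigr => -[i f] _; rewrite ffunE /tens_kernel /=.
by rewrite big_split mulrACA.
Qed.

Lemma tens_perm_pow s w v : tens_perm s (tens_pow p w v) = tens_pow p w v :> tens W1 V p.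
Proof.
apply/ffunP => x; rewrite !ffunE /=; congr (_ * _).
by rewrite [RHS](reindex_inj (@perm_inj _ s)); apply: eq_bigr => q _; rewrite ffunE.
Qed.

Lemma rational_tens_kernelV x y : rational (fun g => tens_kernel (invmx g) x y).
Proof.
apply: rationalM; first exact: rational_fibreV.
by apply: rational_prod => q; exact: rational_fibreV.
Qed.

Variable Phi0 : {linear T -> 'cV[K]_(fdim W2)}.
Hypothesis Phi0_perm : forall s t, Phi0 (tens_perm s t) = Phi0 t.

Definition conj_lin t g := W2 g *m Phi0 (tens_act (invmx g) t).

Definition tens_delta x : T := [ffun y => (y == x)%:R].

Lemma tens_deltaE t : t = \sum_x t x *: tens_delta x.
Proof.
apply/ffunP => y; rewrite sum_ffunE (bigD1 y) //= big1 => [|x xy].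
  by rewrite addr0 !ffunE eqxx [RHS]mulr1.
by rewrite !ffunE eq_sym (negPf xy) [LHS]mulr0.
Qed.

Lemma conj_linE t g a :
  conj_lin t g a 0 = \sum_x t x * conj_lin (tens_delta x) g a 0.
Proof.
rewrite {1}(tens_deltaE t) /conj_lin.
pose aL := GRing.isLinear.Build _ _ _ _ _ (tens_act_linear (invmx g)).
pose act : {linear T -> T} := HB.pack (@tens_act _ _ W1 V p (invmx g) : T -> T) aL.
rewrite -[tens_act _ _]/(act _) !linear_sum summxE; apply: eq_bigr => x _.
by rewrite !linearZ mxE.
Qed.

Lemma rational_conj_lin t a : rational (fun g => conj_lin t g a 0).
Proof.
under eq_fun do rewrite mxE; apply: rational_sum => b.
apply: rationalM; first exact: rational_fibre.
apply: (@rational_eq _ _ (fun g =>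
    \sum_x (\sum_y tens_kernel (invmx g) x y * t y) * Phi0 (tens_delta x) b 0)).
  move=> g _; rewrite [in RHS](tens_deltaE (tens_act _ _)) linear_sum summxE.
  by apply: eq_bigr => x _; rewrite linearZ mxE tens_actE.
apply: rational_sum => x; apply: rationalM; last exact: rational_cst.
apply: rational_sum => y; apply: rationalM; last exact: rational_cst.
exact: rational_tens_kernelV.
Qed.

(** By linearity in [t], an exponent valid for the finitely many basis tensors is valid for all.
    Larger exponents are allowed so that several maps can share one. *)
Lemma conj_lin_rational : exists e0, forall e, (e0 <= e)%N ->
  forall t a b, rational_with e (fun g => conj_lin t g a b).
Proof.
have [|e0 e0R] := @rational_family _ _ (tens_index W1 V p * 'I_(fdim W2))%type
  (fun xa g => conj_lin (tens_delta xa.1) g xa.2 0).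
  by move=> [x a]; exact: rational_conj_lin.
exists e0 => e e0e t a b; rewrite ord1; under eq_fun do rewrite conj_linE.
apply: rational_with_sum => x; apply: rational_withZ.
exact: rational_with_le e0e (e0R (x, a)).
Qed.

Lemma average_natlin e : (forall t a b, rational_with e (fun g => conj_lin t g a b)) ->
  exists Phi : natlin W1 V p W2, forall t, Phi t = gl_avg_mx e (conj_lin t).
Proof.
move=> eR; pose F t := gl_avg_mx e (conj_lin t).
have Flin : linear F.
  move=> c t u; apply/colP => a; rewrite !mxE -gl_avgZ // -gl_avgD //; last first.
    exact: rational_withZ.
  congr gl_avg; apply/funext => g; rewrite /conj_lin tens_act_linear.
  by rewrite linearP mulmxDr -scalemxAr !mxE.
pose FM := GRing.isLinear.Build _ _ _ _ _ Flin.
pose FL : {linear T -> 'cV[K]_(fdim W2)} := HB.pack F FM.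
have Fperm s t : FL (tens_perm s t) = FL t.
  rewrite /FL /= /F; congr gl_avg_mx; apply/funext => g.
  by rewrite /conj_lin tens_act_perm Phi0_perm.
have Fequiv g t : g \in unitmx -> FL (tens_act g t) = W2 g *m FL t.
  (* Substitute g h for the averaging variable h: W2(g h) Phi0((g h)^-1 g t) = W2(g) W2(h) Phi0(h^-1
     t). *)
  move=> gU; rewrite /FL /= /F -gl_avg_mulmxl // -(gl_avg_mx_lmul _ gU) //.
  apply: eq_gl_avg_mx => h hU; rewrite /conj_lin fibre_actM // -tens_actM //.
    by rewrite invmx_mul // mulmxKV // mulmxA.
  by rewrite unitmx_inv unitmx_mul gU.
by exists (NatLin Fperm Fequiv).
Qed.

End TensorAveraging.

Lemma poly_span_seq (K : fieldType) N (Z : pred 'I_N) (s : seq {mpoly K[N]}) p :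
  poly_span Z (fun q => q \in s) p ->
  exists2 c : 'I_(size s) -> {mpoly K[N]}, (forall i, poly_in Z (c i)) &
    p = \sum_i c i * s`_i.
Proof.
have poly_in0 : poly_in Z (0 : {mpoly K[N]}) by move=> m; rewrite msupp0.
move=> [L]; elim: L p => [|[a q] L IH] p LS ->.
  exists (fun=> 0) => //; rewrite big_nil big1 // => i _; exact: mul0r.
have [|c cZ ec] := IH (\sum_(x <- L) x.1 * x.2) _ erefl.
  by move=> x xL; apply: LS; rewrite inE xL orbT.
have [aZ qs] := LS _ (mem_head _ _).
(* Entries of [s] may repeat; the coefficient goes to the first occurrence of [q]. *)
have qi : (index q s < size s)%N by rewrite index_mem.
pose iq := Ordinal qi.
exists (fun i => (if i == iq then a else 0) + c i).
  move=> i m /msuppD_le; rewrite mem_cat => /orP[|]; last exact: cZ.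
  by case: ifP => _ mi; [exact: aZ|exact: poly_in0].
rewrite big_cons ec; under [RHS]eq_bigr do rewrite mulrDl.
rewrite big_split; congr (_ + _).
rewrite (bigD1 iq) //= big1 ?addr0 => [|i /negPf ->]; last exact: mul0r.
by rewrite eqxx nth_index.
Qed.

(** * Finitely many generating natural operations *)

Section Generators.
Variables (K : numFieldType) (n : nat) (V : tensor_bundle K n) (k d : nat).
Local Notation N := #|jet_coord n k (fdim V)|.
Implicit Types (W : tensor_bundle K n).

Definition order0 : pred 'I_N := fun i => jet_order (enum_val i) == 0%N.

Definition jet_eval (J : jet_space K n k (fdim V)) (p : {mpoly K[N]}) : K :=
  meval (fun i => J (enum_val i)) p.

Lemma degree_order0 m :
  degree_outside order0 m = (\sum_(i < N | 0 < jet_order (enum_val i)) m i)%N.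
Proof. by apply: eq_bigl => i; rewrite lt0n. Qed.

Section Projection.
Variables (W W' : tensor_bundle K n) (pr : 'M[K]_(fdim W', fdim W)).
Hypothesis pr_equiv : forall g, g \in unitmx -> pr *m W g = W' g *m pr.
Variable D : natop k d V W.

Lemma natop_proj_algebraic : algebraic_deg_le d (fun J => pr *m fibre_map D J).
Proof.
have [P [PE Pd]] := natop_algebraic D.
exists (fun a => \sum_b pr a b *: P b); split=> [J a|a m].
  rewrite mxE raddf_sum; apply: eq_bigr => b _; rewrite /= mevalZ PE //.
move: m; elim/big_ind: _ => [m|p q IHp IHq m /msuppD_le|b _ m /msuppZ_le].
- by rewrite msupp0.
- by rewrite mem_cat => /orP[/IHp|/IHq].
- exact: Pd.
Qed.

(** Equivariance of [pr] is available at invertible matrices, and the Jacobian of a local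
    diffeomorphism is one. *)
Lemma natop_proj_natural : jet_equivariant (W := W') (fun J => pr *m fibre_map D J).
Proof.
move=> F G FG v vS; rewrite (natop_natural D FG vS) mulmxA pr_equiv ?mulmxA //.
exact: local_diffeo_jac_unit FG.
Qed.

Definition natop_proj : natop k d V W' := NatOp natop_proj_algebraic natop_proj_natural.

End Projection.

Lemma natop_generators : exists (I : finType) (WI : I -> tensor_bundle K n)
    (DI : forall i, natop k d V (WI i)),
  (forall i, indecomposable (WI i)) /\
  forall W (D : natop k d V W) a,
    exists2 c : forall i, 'I_(fdim (WI i)) -> {mpoly K[N]},
      forall i b, poly_in order0 (c i b) &
      forall J, fibre_map D J a 0 =
        \sum_i \sum_b jet_eval J (c i b) * fibre_map (DI i) J b 0.
Proof.
(* The components of operations into all targets are taken together, so that the generators do not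
   depend on the target. *)
pose S (p : {mpoly K[N]}) :=
  (forall m, m \in msupp p -> (degree_outside order0 m <= d)%N) /\
  exists W (D : natop k d V W) a, forall J, fibre_map D J a 0 = jet_eval J p.
have [|s sS sgen] := @poly_span_noetherian _ _ order0 d S; first by move=> q [].
have opE (j : 'I_(size s)) : {W & {D : natop k d V W & {a |
    forall J, fibre_map D J a 0 = jet_eval J s`_j}}}.
  have [_ /cid[W /cid[D /cid[a aE]]]] := sS _ (mem_nth 0 (ltn_ord j)).
  by exists W, D, a.
pose WJ j := projT1 (opE j).
pose DJ j : natop k d V (WJ j) := projT1 (projT2 (opE j)).
pose aJ j : 'I_(fdim (WJ j)) := projT1 (projT2 (projT2 (opE j))).
have DJE j J : fibre_map (DJ j) J (aJ j) 0 = jet_eval J s`_j.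
  exact: (projT2 (projT2 (projT2 (opE j)))).
have decE j : {I : finType & {Wi : I -> tensor_bundle K n &
    {io : forall i, 'M[K]_(fdim (WJ j), fdim (Wi i)) &
    {pr : forall i, 'M[K]_(fdim (Wi i), fdim (WJ j)) |
  [/\ forall i, indecomposable (Wi i),
      forall i g, g \in unitmx -> pr i *m WJ j g = Wi i g *m pr i &
      \sum_i io i *m pr i = 1%:M]}}}}.
  have /cid[I /cid[Wi /cid[io /cid[pr H]]]] := bundle_decomposition (WJ j).
  by exists I, Wi, io, pr.
pose I j := projT1 (decE j).
pose Wi j : I j -> tensor_bundle K n := projT1 (projT2 (decE j)).
pose io j : forall i, 'M[K]_(fdim (WJ j), fdim (Wi j i)) :=
  projT1 (projT2 (projT2 (decE j))).
pose pr j : forall i, 'M[K]_(fdim (Wi j i), fdim (WJ j)) :=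
  projT1 (projT2 (projT2 (projT2 (decE j)))).
have decP j : [/\ forall i, indecomposable (Wi j i),
      forall i g, g \in unitmx -> pr j i *m WJ j g = Wi j i g *m pr j i &
      \sum_i io j i *m pr j i = 1%:M].
  exact: (projT2 (projT2 (projT2 (projT2 (decE j))))).
have prE j i g : g \in unitmx -> pr j i *m WJ j g = Wi j i g *m pr j i.
  by have [_ H _] := decP j; exact: H.
exists {j : 'I_(size s) & I j}, (fun x => Wi (tag x) (tagged x)),
  (fun x => natop_proj (prE (tag x) (tagged x)) (DJ (tag x))).
split=> [[j i]|W D a]; first by have [H _ _] := decP j; exact: H.
have [P [PE Pd]] := natop_algebraic D.
have [|c cZ cE] := poly_span_seq (sgen (P a) _).
  split; last by exists W, D, a => J; exact: PE.
  move=> m mP; rewrite degree_order0. exact: Pd a m mP.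
(* The generator is the component [aJ] of [DJ]; row [aJ] of the decomposition of the identity
   expresses it by the components of the projected operations. *)
exists (fun x b => io (tag x) (tagged x) (aJ (tag x)) b *: c (tag x)).
  by move=> x b m /msuppZ_le; exact: cZ.
move=> J; rewrite PE cE raddf_sum /=.
transitivity (\sum_j jet_eval J (c j) * fibre_map (DJ j) J (aJ j) 0).
  by apply: eq_bigr => j _; rewrite DJE /jet_eval mevalM.
rewrite -(@sig_big_dep _ _ _ _ I xpredT (fun _ => xpredT) (fun j i =>
  \sum_b jet_eval J (io j i (aJ j) b *: c j) *
  (pr j i *m fibre_map (DJ j) J) b 0)) /=.
apply: eq_bigr => j _; have [_ _ sum1] := decP j.
rewrite -[in LHS](mul1mx (fibre_map (DJ j) J)) -sum1 mulmx_suml summxE mulr_sumr.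
apply: eq_bigr => i _; rewrite -mulmxA mxE mulr_sumr; apply: eq_bigr => b _.
by rewrite /jet_eval mevalZ mulrCA mulrA.
Qed.

End Generators.

(** * Symmetrizing linear maps in the tensor powers *)

Section Symmetrization.
Variables (K : numFieldType) (n : nat) (W1 V W2 : tensor_bundle K n) (p : nat).
Local Notation T := {ffun tens_index W1 V p -> K^o}.

Definition tens_sym (t : T) : T := (p`!%:R^-1 : K) *: \sum_(s : 'S_p) tens_perm s t.

Lemma tens_perm_linear s : linear (@tens_perm _ _ W1 V p s : T -> T).
Proof. by move=> c t u; apply/ffunP => x; rewrite !ffunE. Qed.

Lemma tens_sym_linear : linear tens_sym.
Proof.
move=> c t u; rewrite /tens_sym scalerA mulrC -scalerA -scalerDr; congr (_ *: _).
rewrite scaler_sumr -big_split; apply: eq_bigr => s _.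
exact: tens_perm_linear.
Qed.

Lemma tens_sym_perm s t : tens_sym (tens_perm s t) = tens_sym t.
Proof.
rewrite /tens_sym [in RHS](reindex_inj (mulgI s)); congr (_ *: _).
apply: eq_bigr => s' _; apply/ffunP => x; rewrite !ffunE; congr (t (_, _)).
by apply/ffunP => q; rewrite !ffunE permM.
Qed.

Lemma tens_sym_pow w v : tens_sym (tens_pow p w v) = tens_pow p w v.
Proof.
rewrite /tens_sym; under eq_bigr do rewrite tens_perm_pow.
rewrite sumr_const card_Sn; apply/ffunP => x; rewrite ffunE ffunMnE.
by rewrite -[X in _ *: X]mulr_natl [LHS]mulKf // pnatr_eq0 -lt0n fact_gt0.
Qed.

(** Symmetrizing the argument first makes the form invariant under permutations and keeps its values
    on w (x) v^p, which are already symmetric. *)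
Lemma symmetric_linear_form (gam : 'I_(fdim W2) -> tens_index W1 V p -> K) :
  exists2 Phi : {linear T -> 'cV[K]_(fdim W2)},
    forall s t, Phi (tens_perm s t) = Phi t &
    forall w v a, Phi (tens_pow p w v) a 0 = \sum_x gam a x * tens_pow p w v x.
Proof.
pose F t := \col_a \sum_x gam a x * tens_sym t x.
have Flin : linear F.
  move=> c t u; apply/colP => a; rewrite !mxE mulr_sumr -big_split.
  by apply: eq_bigr => x _; rewrite tens_sym_linear !ffunE mulrDr -scalerAr.
pose FM := GRing.isLinear.Build _ _ _ _ _ Flin.
pose FL : {linear T -> 'cV[K]_(fdim W2)} := HB.pack F FM.
exists FL => [s t|w v a]; first by rewrite /FL /= /F tens_sym_perm.
by rewrite /FL /= mxE tens_sym_pow.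
Qed.

End Symmetrization.

(** A monomial is written out as a word with one tensor index per factor; [comp] will send a jet
    coordinate to its component in the fibre of [V]. *)
Lemma monomial_prod (K : comNzRingType) N f (m : multinom N) (comp : 'I_N -> 'I_f) :
  exists b : {ffun 'I_(mdeg m) -> 'I_f}, forall x : 'I_f -> K,
    \prod_i x (comp i) ^+ m i = \prod_q x (b q).
Proof.
pose l := flatten [seq nseq (m i) (comp i) | i <- enum 'I_N].
have sl : size l = mdeg m.
  rewrite size_flatten /shape -map_comp sumnE big_map mdegE big_enum /=.
  by apply: eq_bigr => i _; rewrite size_nseq.
exists [ffun q => tnth (tcast sl (in_tuple l)) q] => x.
transitivity (\prod_(c <- l) x c).
  rewrite big_flatten big_map big_enum /=; apply: eq_bigr => i _.
  by rewrite big_nseq; elim: (m i) => [|e IH]; rewrite ?expr0 // exprS IH.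
transitivity (\prod_(c <- tcast sl (in_tuple l)) x c); first by rewrite val_tcast.
by rewrite big_tuple; apply: eq_bigr => q _; rewrite ffunE.
Qed.

(** * Functions of (w, v) that are linear forms in the tensors w_i (x) v^p *)

Section TensorForms.
Variables (K : numFieldType) (n : nat) (V : tensor_bundle K n).
Variables (I : finType) (WI : I -> tensor_bundle K n).
Local Notation fibres := (forall i, 'cV[K]_(fdim (WI i))).
Implicit Types (h : fibres -> 'cV[K]_(fdim V) -> K).

(* Any larger [P] is allowed, so that forms with different bounds can be added. *)
Definition tens_form h :=
  exists (gam : forall i p, tens_index (WI i) V p -> K) (P0 : nat),
  forall P, (P0 <= P)%N -> forall w v,
    h w v = \sum_i \sum_(p < P) \sum_x gam i p x * tens_pow p (w i) v x.

Lemma tens_form_eq h1 h2 : (forall w v, h1 w v = h2 w v) -> tens_form h1 -> tens_form h2.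
Proof. by move=> h12 [gam [P0 E]]; exists gam, P0 => P PP w v; rewrite -h12 (E P). Qed.

Lemma tens_form0 : tens_form (fun _ _ => 0).
Proof.
exists (fun _ _ _ => 0), 0%N => P _ w v; rewrite big1 // => i _.
by rewrite big1 // => p _; rewrite big1 // => x _; rewrite mul0r.
Qed.

Lemma tens_formD h1 h2 : tens_form h1 -> tens_form h2 ->
  tens_form (fun w v => h1 w v + h2 w v).
Proof.
move=> [g1 [P1 E1]] [g2 [P2 E2]]; exists (fun i p x => g1 i p x + g2 i p x), (maxn P1 P2).
move=> P; rewrite geq_max => /andP[PP1 PP2] w v; rewrite (E1 P) // (E2 P) //.
rewrite -big_split; apply: eq_bigr => i _; rewrite -big_split; apply: eq_bigr => p _.
by rewrite -big_split; apply: eq_bigr => x _; rewrite mulrDl.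
Qed.

Lemma tens_formZ c h : tens_form h -> tens_form (fun w v => c * h w v).
Proof.
move=> [gam [P0 E]]; exists (fun i p x => c * gam i p x), P0 => P PP w v.
rewrite (E P) // mulr_sumr; apply: eq_bigr => i _; rewrite mulr_sumr.
apply: eq_bigr => p _; rewrite mulr_sumr; apply: eq_bigr => x _.
by rewrite mulrA.
Qed.

Lemma tens_form_sum (J : Type) (s : seq J) (F : J -> fibres -> 'cV[K]_(fdim V) -> K) :
  (forall j, tens_form (F j)) -> tens_form (fun w v => \sum_(j <- s) F j w v).
Proof.
move=> FE; elim: s => [|j s IH].
  by apply: tens_form_eq tens_form0 => w v; rewrite big_nil.
by apply: tens_form_eq (tens_formD (FE j) IH) => w v; rewrite big_cons.
Qed.

Lemma tens_form_monomial i0 p0 (b0 : 'I_(fdim (WI i0)))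
    (f0 : {ffun 'I_p0 -> 'I_(fdim V)}) :
  tens_form (fun w v => w i0 b0 0 * \prod_q v (f0 q) 0).
Proof.
(* [x.1] and [b0] have different types unless [i] is [i0], so their values are
   compared; likewise for [x.2] and [f0]. *)
pose gam i p (x : tens_index (WI i) V p) : K :=
  [&& i == i0, p == p0, x.1 == b0 :> nat & codom x.2 == codom f0]%:R.
exists gam, p0.+1 => P PP w v.
rewrite (bigD1 i0) //= [X in _ + X]big1 ?addr0 => [|i /negPf ii]; last first.
  by rewrite big1 // => p _; rewrite big1 // => x _; rewrite /gam ii mul0r.
rewrite (bigD1 (Ordinal PP)) //= [X in _ + X]big1 ?addr0 => [|p pp]; last first.
  rewrite big1 // => x _; rewrite /gam (_ : (p : nat) == p0 = false) ?andbF ?mul0r //.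
  by apply: contra_neqF pp => /eqP pp; apply: val_inj.
rewrite [in RHS](bigD1 (b0, f0)) //= [X in _ + X]big1 ?addr0 => [|[b f] bf].
  by rewrite /gam !eqxx /= mul1r ffunE.
rewrite /gam !eqxx /= (_ : _ && _ = false) ?mul0r //.
apply: contra_neqF bf => /andP[/eqP bb /eqP ff]; congr (_, _); first exact: val_inj.
apply/ffunP => q; move: ff; rewrite !codomE => /eq_in_map; apply.
by rewrite mem_enum.
Qed.

End TensorForms.

(** * Order-0 coefficients as polynomials in the value of the field *)

Section JetValues.
Variables (K : numFieldType) (n : nat) (V : tensor_bundle K n) (k : nat).
Local Notation N := #|jet_coord n k (fdim V)|.

Lemma jet_order0 (u : 'cV[K]_n -> 'cV[K]_(fdim V)) x (i : 'I_N) :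
  order0 i -> jet k u x (enum_val i) = u x (enum_val i).2 0.
Proof.
rewrite /order0 /jet_order mdeg_eq0 ffunE /mpartial => /eqP ->.
suff -> : [seq nseq (@mnm0 n j) j | j <- enum 'I_n] = [seq [::] | j <- enum 'I_n].
  by elim: (enum 'I_n).
by apply: eq_map => j; rewrite mnm0E.
Qed.

Lemma jet_eval_tens_form (I : finType) (WI : I -> tensor_bundle K n)
    (c : forall i, 'I_(fdim (WI i)) -> {mpoly K[N]}) :
  (forall i b, poly_in (@order0 K n V k) (c i b)) ->
  exists2 h, tens_form (V := V) h & forall (w : forall i, 'cV[K]_(fdim (WI i))) u x,
    h w (u x) = \sum_i \sum_b jet_eval (jet k u x) (c i b) * w i b 0.
Proof.
move=> cZ.
(* Every jet coordinate is replaced by the component of [v] of the same index. This is correct in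
   order 0, and the coordinates of positive order have exponent 0 in the monomials of [c i b]. *)
exists (fun w v => \sum_i \sum_b \sum_(m <- msupp (c i b)) mcoeff m (c i b) *
  (w i b 0 * \prod_l v (enum_val l).2 0 ^+ m l)).
  apply: tens_form_sum => i; apply: tens_form_sum => b; apply: tens_form_sum => m.
  apply: tens_formZ.
  have [f fE] := monomial_prod K m (fun l : 'I_N => (enum_val l).2).
  apply: tens_form_eq (tens_form_monomial (V := V) b f) => w v.
  by rewrite (fE (fun j => v j 0)).
move=> w u x; apply: eq_bigr => i _; apply: eq_bigr => b _.
rewrite /jet_eval mevalE mulr_suml; apply: eq_big_seq => m mc.
rewrite -mulrA [w _ _ _ * _]mulrC; congr (_ * (_ * _)); apply: eq_bigr => l _.
have [Zl|Zl] := boolP (order0 l); first by rewrite jet_order0.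
by rewrite (cZ _ _ _ mc).
Qed.

End JetValues.

(** * Averaging the representation of a natural operation *)

Theorem theorem3 (R : realType) (K : numFieldType)
    (hK : K = (R : numFieldType) \/ K = (R[i] : numFieldType))
    (n : nat) (V : tensor_bundle K n)
    (k d : nat) (hk : (0 < k)%N) (hd : (0 < d)%N) :
  exists (N : nat) (Wi : 'I_N -> tensor_bundle K n)
         (Di : forall i : 'I_N, natop k d V (Wi i)),
    (forall i, indecomposable (Wi i)) /\
    forall (W : tensor_bundle K n) (D : natop k d V W),
      exists (P : nat) (Phi : forall (i : 'I_N) (p : 'I_P), natlin (Wi i) V p W),
        forall (M : manifold K n) (v : tsection V M) (c : chart M) (y : 'cV[K]_n),
          chart_cod c y ->
          natop_apply D v c y =
          \sum_(i < N) \sum_(p < P)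
             Phi i p (tens_pow p (natop_apply (Di i) v c y) (v c y)).
Proof.
have [I [WI [DI [indI genI]]]] := natop_generators V k d.
exists #|I|, (fun i => WI (enum_val i)), (fun i => DI (enum_val i)).
split=> // W D.
pose Wi (i : 'I_#|I|) := WI (enum_val i).
pose Di (i : 'I_#|I|) : natop k d V (Wi i) := DI (enum_val i).
have formE a : {gP : (forall i p, tens_index (WI i) V p -> K) * nat |
    forall P, (gP.2 <= P)%N -> forall u x,
    fibre_map D (jet k u x) a 0 = \sum_i \sum_(p < P) \sum_t
      gP.1 i p t * tens_pow p (fibre_map (DI i) (jet k u x)) (u x) t}.
  apply: cid; have [c cZ cE] := genI W D a.
  have [h [gam [P0 hE]] hc] := jet_eval_tens_form cZ.
  exists (gam, P0) => P PP u x; rewrite cE.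
  by rewrite -(hc (fun i => fibre_map (DI i) (jet k u x))) (hE P).
(* Each component of [D] has its own bound on p; the maximum gives one range for the vector
   identity. *)
pose P := \max_a (projT1 (formE a)).2.
have PhiE (i : 'I_#|I|) (p : 'I_P) := symmetric_linear_form
  (fun a => (projT1 (formE a)).1 (enum_val i) p : tens_index (Wi i) V p -> K).
pose Phi0 i p := projT1 (cid2 (PhiE i p)).
have Phi0_perm i p s t : Phi0 i p (tens_perm s t) = Phi0 i p t.
  by rewrite /Phi0; case: cid2.
have Phi0E u x : fibre_map D (jet k u x) =
    \sum_i \sum_p Phi0 i p (tens_pow p (fibre_map (Di i) (jet k u x)) (u x)).
  apply/colP => a; have := projT2 (formE a) P (leq_bigmax a) u x => ->.
  rewrite (reindex_onto enum_val enum_rank) /=; last by move=> i _; rewrite enum_rankK.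
  rewrite summxE; apply: eq_big => [i|i _]; first by rewrite enum_valK eqxx.
  rewrite summxE; apply: eq_bigr => p _.
  by rewrite /Phi0; case: cid2 => /= F _ ->.
have ratE (i : 'I_#|I|) (p : 'I_P) := conj_lin_rational (Phi0 i p).
(* All terms must be averaged over the same power of the determinant. *)
pose e := \max_(ip : 'I_#|I| * 'I_P) projT1 (cid (ratE ip.1 ip.2)).
have eR i p t a b : rational_with e (fun g => conj_lin (Phi0 i p) t g a b).
  apply: (projT2 (cid (ratE i p))).
  exact: (leq_bigmax (F := fun ip => projT1 (cid (ratE ip.1 ip.2))) (i, p)).
pose Phi i p := projT1 (cid (average_natlin (Phi0_perm i p) (eR i p))).
have PhiP i p t : Phi i p t = gl_avg_mx e (conj_lin (Phi0 i p) t).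
  exact: (projT2 (cid (average_natlin (Phi0_perm i p) (eR i p)))).
exists P, Phi => M v c y cy.
rewrite /natop_apply /= /natop_expr.
(* Naturality concerns jets at 0, so the point y is translated to 0. *)
pose u := v c \o shift y.
have uS : \forall x \near (0 : 'cV[K]_n), smooth_at u x.
  have : nbhs y (chart_cod c) by apply: open_nbhs_nbhs; split=> //; exact: chart_cod_open.
  move=> /(nbhs0P (chart_cod c) y); apply: filterS => x cx; apply: smooth_at_shift.
  by apply: local_smooth; rewrite addrC.
have uJ : jet k (v c) y = jet k u 0 by rewrite jet_shift add0r.
have u0 : v c y = u 0 by rewrite /u /= add0r.
rewrite uJ u0; set J := jet k u 0.
have natE (W' : tensor_bundle K n) (D' : natop k d V W') g : g \in unitmx ->
    fibre_map D' (jet k (@mx_pushforward _ _ V (invmx g) u) 0) =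
    W' (invmx g) *m fibre_map D' J.
  move=> gU; have gU' : invmx g \in unitmx by rewrite unitmx_inv.
  by rewrite (natop_natural D' (local_diffeo_mulmx gU') uS) jacmx_mulmx.
(* The identity [Phi0E], applied to [u] transformed by g^-1, is combined with naturality of [D] and
   the [Di] and multiplied by W(g). *)
have avgE g : g \in unitmx -> fibre_map D J = \sum_i \sum_p
    conj_lin (Phi0 i p) (tens_pow p (fibre_map (Di i) J) (u 0)) g.
  move=> gU; have := congr1 (mulmx (W g)) (natE _ D g gU).
  rewrite mulmxA fibre_actKV // mul1mx => <-; rewrite Phi0E mulmx_sumr.
  apply: eq_bigr => i _; rewrite mulmx_sumr; apply: eq_bigr => p _.
  by rewrite natE // mx_pushforwardE mulmx0 /conj_lin tens_act_pow.
(* The left side is constant in g, hence equal to its average; the right side is averaged term by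
   term. *)
rewrite -[LHS](gl_avg_mx_cst n e) (eq_gl_avg_mx e avgE).
rewrite gl_avg_mx_sum => [|i]; last exact: rational_with_sum_mx.
apply: eq_bigr => i _; rewrite gl_avg_mx_sum //; apply: eq_bigr => p _.
by rewrite PhiP.
Qed.
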